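(* Let $d\in\mathbb{N}$, $d\ge2$, $r_k>0$, $1<p_k\le q<\infty$ for all $k=1,\dots,d$. Suppose that there is $j\in\{1,\dots,d\}$ such that $$\sum_{i=1}^d\frac1{r_i}\left(\frac1{p_i}-\frac1{p_j}\right)\ge1.$$ Then $W^{\overline{r}}_{\overline{p}}(\mathbb{T}^d)$ is not compactly embedded into $L_q(\mathbb{T}^d)$.
   Context: Function class: $\mathbb{T}^d=[0,2\pi]^d$; $\mathcal{S}'(\mathbb{T}^d)$ is the space of periodic distributions (test functions: infinitely smooth periodic functions); each $f\in\mathcal{S}'(\mathbb{T}^d)$ has a Fourier series $f=\sum_{\overline{k}\in\mathbb{Z}^d}c_{\overline{k}}(f)e^{i(\overline{k},\cdot)}$. Let $\mathring{\mathbb{Z}}^d=\{\overline{k}\in\mathbb{Z}^d: k_1k_2\cdots k_d\ne0\}$ and let $\mathring{\mathcal{S}}'(\mathbb{T}^d)$ be the set of $f\in\mathcal{S}'(\mathbb{T}^d)$ with $c_{\overline{k}}(f)=0$ for all $\overline{k}\notin\mathring{\mathbb{Z}}^d$. The Weyl derivative of order $r_j$ in the variable $x_j$ of $f\in\mathring{\mathcal{S}}'(\mathbb{T}^d)$ is $\partial_j^{r_j}f=\sum_{\overline{k}\in\mathring{\mathbb{Z}}^d}c_{\overline{k}}(f)(ik_j)^{r_j}e^{i(\overline{k},\cdot)}$, where $(ik_j)^{r_j}=|k_j|^{r_j}e^{\mathrm{sgn}(k_j)\, i\pi r_j/2}$. With $\overline{p}=(p_1,\dots,p_d)$, $\overline{r}=(r_1,\dots,r_d)$,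 $$W^{\overline{r}}_{\overline{p}}(\mathbb{T}^d)=\{f\in\mathring{\mathcal{S}}'(\mathbb{T}^d):\ \|\partial_j^{r_j}f\|_{L_{p_j}(\mathbb{T}^d)}\le1,\ 1\le j\le d\}.$$ ''Compactly embedded into $L_q(\mathbb{T}^d)$'' means: contained in $L_q(\mathbb{T}^d)$ and relatively compact there. *)

(* Defs.v *)
From HB Require Import structures.
From mathcomp Require Import all_boot all_order all_algebra.
From mathcomp Require Import all_classical all_reals all_analysis.
From mathcomp Require Import measurable_realfun complex.

Set Implicit Arguments.
Unset Strict Implicit.
Unset Printing Implicit Defensive.
Import Order.TTheory GRing.Theory Num.Theory numFieldNormedType.Exports.
Local Open Scope classical_set_scope.
Local Open Scope ring_scope.

Section circle_measure.
Context (R : realType).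

Definition circle_measure : set (measurableTypeR R) -> \bar R :=
  mrestr lebesgue_measure (measurable_itv `[0 : R, 2 * pi]).

HB.instance Definition _ := Measure.on circle_measure.

Let circle_measure_fin : fin_num_fun circle_measure.
Proof.
apply: lty_fin_num_fun.
suff : (lebesgue_measure ([set: R] `&` `[0%R, (2 * pi)%R]%classic) < +oo)%E by [].
by rewrite setTI lebesgue_measure_itv/=; case: ifPn; rewrite ?ltry.
Qed.

HB.instance Definition _ :=
  Measure_isFinite.Build _ _ _ circle_measure circle_measure_fin.

End circle_measure.

Section torus_measure.
Context (R : realType).

Definition tcons n (z : measurableTypeR R * n.-tuple (measurableTypeR R)) :
  n.+1.-tuple (measurableTypeR R) := [tuple of z.1 :: z.2].

Lemma measurable_tcons n : measurable_fun [set: _] (@tcons n).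
Proof. exact: measurable_cons. Qed.

HB.instance Definition _ n :=
  isMeasurableFun.Build _ _ _ _ (@tcons n) (@measurable_tcons n).


Section step.
Context (n : nat)
  (m : {finite_measure set n.-tuple (measurableTypeR R) -> \bar R}).

Definition torus_step : set (n.+1.-tuple (measurableTypeR R)) -> \bar R :=
  pushforward (circle_measure (R:=R) \x m)%E (@tcons n).

Let torus_step0 : torus_step set0 = 0%E.
Proof. by rewrite /torus_step /pushforward preimage_set0 measure0. Qed.

Let torus_step_ge0 A : (0 <= torus_step A)%E.
Proof. exact: measure_ge0. Qed.

Let torus_step_sigma_additive : semi_sigma_additive torus_step.
Proof.
pose mf := @measurable_tcons n.
apply: (@measure_semi_sigma_additive _ _ _
  (measure_function_pushforward__canonical__measure_function_Measure _ mf)).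
Qed.

HB.instance Definition _ := isMeasure.Build _ _ _ torus_step
  torus_step0 torus_step_ge0 torus_step_sigma_additive.

Let torus_step_fin : fin_num_fun torus_step.
Proof.
apply: lty_fin_num_fun.
suff : ((circle_measure (R:=R) \x m) ([set: _] `*` [set: _]) < +oo)%E.
  by rewrite setXTT.
rewrite product_measure1E// lte_mul_pinfty ?fin_num_measure//.
by rewrite ltey_eq fin_num_measure.
Qed.

HB.instance Definition _ :=
  Measure_isFinite.Build _ _ _ torus_step torus_step_fin.
End step.

(* The d-fold product of Lebesgue measure on [0, 2 pi], that is, Lebesgue
   measure on R^d restricted to the cube [0, 2 pi]^d (it is not normalized, the
   total mass being (2 pi)^d). *)
Fixpoint torus_measure n :
    {finite_measure set n.-tuple (measurableTypeR R) -> \bar R} :=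
  match n with
  | 0 => (\d_([tuple] : 0.-tuple (measurableTypeR R)) : {finite_measure set _ -> \bar R})
  | n.+1 => (torus_step (torus_measure n) : {finite_measure set _ -> \bar R})
  end.

End torus_measure.
Section test_functions.
Context (R : realType) (d : nat).
Implicit Types (u v : 'rV[R]_d -> R) (s : seq 'I_d).

Definition unit_vec (j : 'I_d) : 'rV[R]_d := delta_mx ord0 j.

Definition pderiv (j : 'I_d) u : 'rV[R]_d -> R := fun x => 'D_(unit_vec j) u x.

Definition iter_pderiv s u : 'rV[R]_d -> R := foldr pderiv u s.

(* C^infinity: all iterated partial derivatives, in any order, exist and are
   continuous. *)
Definition smooth u := forall s, continuous (iter_pderiv s u) /\
  forall (j : 'I_d) x, derivable (iter_pderiv s u) x (unit_vec j).

(* Complex-valued functions are differentiated componentwise because R[i] is a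
   normed module over R[i] only, not over R. *)
Definition is_test (h : 'rV[R]_d -> R[i]^o) :=
  [/\ smooth (fun x => complex.Re (h x)), smooth (fun x => complex.Im (h x)) &
      forall j : 'I_d, periodic h ((2 * pi) *: unit_vec j)].

Definition test_pred : {pred 'rV[R]_d -> R[i]^o} := fun h => `[< is_test h >].

Lemma iter_pderiv_lin s (a b : R) u v : smooth u -> smooth v ->
  iter_pderiv s (fun x => a * u x + b * v x) =
  (fun x => a * iter_pderiv s u x + b * iter_pderiv s v x).
Proof.
move=> su sv; elim: s => //= j s ->; apply/funext => x; rewrite /pderiv.
have [_ du] := su s; have [_ dv] := sv s.
rewrite (@deriveD _ _ _ (a \*: iter_pderiv s u) (b \*: iter_pderiv s v));
  [|exact: derivableZ|exact: derivableZ].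
by rewrite !deriveZ.
Qed.

Lemma smooth_lin (a b : R) u v : smooth u -> smooth v ->
  smooth (fun x => a * u x + b * v x).
Proof.
move=> su sv s; rewrite iter_pderiv_lin//.
have [cu du] := su s; have [cv dv] := sv s; split=> [x|j x].
  by apply: (@continuousD _ _ _ (a \*: iter_pderiv s u) (b \*: iter_pderiv s v));
    apply: continuousZr => //; [exact: cu|exact: cv].
by apply: (@derivableD _ _ _ (a \*: iter_pderiv s u) (b \*: iter_pderiv s v));
  exact: derivableZ.
Qed.

Lemma smooth0 : smooth (fun=> 0).
Proof.
move=> s; have -> : iter_pderiv s (fun=> 0) = cst 0.
  elim: s => //= j s ->; apply/funext => x; exact: derive_cst.
by split=> *; [exact: cst_continuous|exact: derivable_cst].
Qed.

Lemma test_submod_closed : submod_closed test_pred.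
Proof.
split=> [|a f g].
  by apply/asboolP; split=> //; exact: smooth0.
move=> /asboolP[f1 f2 fp] /asboolP[g1 g2 gp]; apply/asboolP; split.
- have := smooth_lin 1 1 (smooth_lin (complex.Re a) (- complex.Im a) f1 f2) g1.
  congr smooth; apply/funext => x; rewrite !fctE.
  rewrite !mul1r.
  by move: a (f x) (g x) => [? ?] [? ?] [? ?] /=; rewrite mulNr.
- have := smooth_lin 1 1 (smooth_lin (complex.Re a) (complex.Im a) f2 f1) g2.
  congr smooth; apply/funext => x; rewrite !fctE.
  rewrite !mul1r.
  by move: a (f x) (g x) => [? ?] [? ?] [? ?] /=.
- by move=> j x; rewrite !fctE fp gp.
Qed.

HB.instance Definition _ :=
  GRing.isSubmodClosed.Build _ _ test_pred test_submod_closed.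

Record test_function := TestFunction {
  test_fun :> 'rV[R]_d -> R[i]^o;
  _ : test_fun \in test_pred }.

HB.instance Definition _ := [isSub for test_fun].
HB.instance Definition _ := [Choice of test_function by <:].
HB.instance Definition _ := [SubChoice_isSubLmodule of test_function by <:].

End test_functions.
Section harmonics.
Context (R : realType) (d : nat).

Definition freq := 'rV[int]_d.

Definition phase (k : freq) (x : 'rV[R]_d) : R :=
  \sum_(j < d) (k ord0 j)%:~R * x ord0 j.

Definition expi (t : R) : R[i] := (cos t +i* sin t)%C.

Let cossin (a b : R) (k : freq) (x : 'rV[R]_d) :=
  a * cos (phase k x) + b * sin (phase k x).

Let phase_shift k x (j : 'I_d) (h : R) :
  phase k (h *: unit_vec R j + x) = h * (k ord0 j)%:~R + phase k x.
Proof.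
rewrite /phase (bigD1 j)//= [in RHS](bigD1 j)//= !mxE !eqxx/=.
rewrite mulr1 mulrDr mulrC -!addrA; congr (_ + (_ + _)).
by apply: eq_bigr => i ij; rewrite !mxE eqxx/= (negbTE ij) mulr0 add0r.
Qed.

Let continuous_phase k : continuous (phase k).
Proof.
rewrite /phase => x; elim: (index_enum _) => [|j l ih].
  under eq_fun do rewrite big_nil.
  exact: cst_continuous.
under eq_fun do rewrite big_cons.
apply: (@continuousD _ _ _ (fun y : 'rV[R]_d => (k ord0 j)%:~R * y ord0 j)
  (fun y => \sum_(i <- l) (k ord0 i)%:~R * y ord0 i)); last exact: ih.
apply: (@continuousM _ _ (cst (k ord0 j)%:~R) (fun y : 'rV[R]_d => y ord0 j)).
  exact: cst_continuous.
exact: coord_continuous.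
Qed.

Let is_derive_cossin a b k x j :
  is_derive x (unit_vec R j) (cossin a b k)
    (cossin (b * (k ord0 j)%:~R) (- (a * (k ord0 j)%:~R)) k x).
Proof.
set c : R := (k ord0 j)%:~R; set p := phase k x.
pose g (h : R) := a * cos (h * c + p) + b * sin (h * c + p).
have gE h : cossin a b k (h *: unit_vec R j + x) = g h.
  by rewrite /cossin !phase_shift.
have dg : is_derive (0 : R) 1 g (cossin (b * c) (- (a * c)) k x).
  rewrite /g; apply: is_derive_eq; rewrite /cossin -/p /GRing.scale/=.
  rewrite !mul0r !add0r !addr0 !mulr1.
  by rewrite mulNr mulrN mulrA mulNr addrC mulrAC [a * c * _]mulrAC mulrA [b * c * _]mulrAC.
apply: DeriveDef.
  apply/derivable1P.
  have -> : (fun h => cossin a b k (h *: unit_vec R j + x)) = g.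
    by rewrite funeqE => h; rewrite gE.
  by [].
have [_ <-] := dg.
rewrite /derive.
have gx : g 0 = cossin a b k x by rewrite -gE scale0r add0r.
have E h : cossin a b k (h *: unit_vec R j + x) = g (h%:A + 0).
  by rewrite gE [h%:A]mulr1 addr0.
under [in LHS]eq_fun do rewrite /= E -gx.
by [].
Qed.

Let smooth_cossin a b k : smooth (cossin a b k).
Proof.
have E s : exists a' b', iter_pderiv s (cossin a b k) = cossin a' b' k.
  elim: s => [|j s [a' [b' /= ->]]]; first by exists a, b.
  exists (b' * (k ord0 j)%:~R), (- (a' * (k ord0 j)%:~R)); apply/funext => x.
  exact: (@derive_val _ _ _ _ _ _ _ (is_derive_cossin a' b' k x j)).
move=> s; have [a' [b' ->]] := E s; split=> [x|j x].
  apply: (@continuousD _ _ _ (fun y => a' * cos (phase k y))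
    (fun y => b' * sin (phase k y))).
    apply: (@continuousM _ _ (cst a') (fun y => cos (phase k y))).
      exact: cst_continuous.
    by apply: continuous_comp; [exact: continuous_phase|exact: continuous_cos].
  apply: (@continuousM _ _ (cst b') (fun y => sin (phase k y))).
    exact: cst_continuous.
  by apply: continuous_comp; [exact: continuous_phase|exact: continuous_sin].
exact: (@ex_derive _ _ _ _ _ _ _ (is_derive_cossin a' b' k x j)).
Qed.

Let expi_period (t : R) (m : int) : expi (2 * pi * m%:~R + t) = expi t.
Proof.
have pE : 2 * pi = pi *+ 2 :> R by rewrite mulr_natl.
case: m => n; rewrite ?NegzE ?mulrNz pE addrC /expi.
  rewrite -[n%:~R]/(n%:R) mulr_natr.
  by rewrite (periodicn (@cosD2pi R)) (periodicn (@sinD2pi R)).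
rewrite -[n.+1%:~R]/(n.+1%:R) mulrN mulr_natr.
rewrite -(periodicn (@cosD2pi R) n.+1) -(periodicn (@sinD2pi R) n.+1).
by rewrite subrK.
Qed.

Definition harmonic (k : freq) : 'rV[R]_d -> R[i]^o := fun x => expi (phase k x).

Lemma harmonic_test k : harmonic k \in (@test_pred R d).
Proof.
apply/asboolP; split.
- have := smooth_cossin 1 0 k; congr smooth; apply/funext => x.
  by rewrite /cossin mul1r mul0r addr0.
- have := smooth_cossin 0 1 k; congr smooth; apply/funext => x.
  by rewrite /cossin mul1r mul0r add0r.
- by move=> j x; rewrite /harmonic addrC phase_shift expi_period.
Qed.

Definition harmonic_test_function k : test_function R d :=
  TestFunction (harmonic_test k).

End harmonics.
Section Lebesgue_spaces.
Context (R : realType) (d : nat).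

Definition torus := d.-tuple (measurableTypeR R).
Implicit Types (h g : torus -> R[i]).

Definition cmeasurable h :=
  measurable_fun [set: torus] (fun x => complex.Re (h x)) /\
  measurable_fun [set: torus] (fun x => complex.Im (h x)).

Definition cintegral h : R[i] :=
  (Rintegral (torus_measure R d) setT (fun x => complex.Re (h x)) +i*
   Rintegral (torus_measure R d) setT (fun x => complex.Im (h x)))%C.

Definition cmod (z : R[i]) : R := ComplexField.Normc.normc z.

Definition cLnorm (p : R) h : \bar R :=
  Lnorm (torus_measure R d) p%:E (fun x => (cmod (h x))%:E).

Lemma cmodE (z : R[i]) : (cmod z)%:C%C = `|z|.
Proof. by case: z. Qed.

Lemma cmod_ge0 (z : R[i]) : 0 <= cmod z.
Proof. by rewrite -lecR cmodE normr_ge0. Qed.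

Lemma cmod0 : cmod 0 = 0.
Proof. exact: ComplexField.Normc.normc0. Qed.

Lemma cmodN (z : R[i]) : cmod (- z) = cmod z.
Proof. by apply: complexI; rewrite !cmodE normrN. Qed.

Lemma cmodD (z w : R[i]) : cmod (z + w) <= cmod z + cmod w.
Proof. by rewrite -lecR rmorphD/= !cmodE ler_normD. Qed.

Lemma measurable_cmod h : cmeasurable h ->
  measurable_fun [set: torus] (fun x => cmod (h x)).
Proof.
move=> [mr mi].
have -> : (fun x => cmod (h x)) = (@Num.sqrt R) \o
    ((fun x => complex.Re (h x) ^+ 2) \+ (fun x => complex.Im (h x) ^+ 2)).
  by apply/funext => x; rewrite /cmod /=; case: (h x).
apply: (measurableT_comp (continuous_measurable_fun (@sqrt_continuous R))).
by apply: measurable_funD; exact: measurable_funX.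
Qed.

Lemma cmeasurableB h g : cmeasurable h -> cmeasurable g ->
  cmeasurable (h \- g).
Proof.
move=> [hr hi] [gr gi]; split.
  rewrite (_ : (fun _ => _) =
    (fun x => complex.Re (h x)) \- (fun x => complex.Re (g x))).
    exact: measurable_funB.
  by apply/funext => x /=; case: (h x) (g x) => [? ?] [].
rewrite (_ : (fun _ => _) =
  (fun x => complex.Im (h x)) \- (fun x => complex.Im (g x))).
  exact: measurable_funB.
by apply/funext => x /=; case: (h x) (g x) => [? ?] [].
Qed.

Lemma cLnorm_triangle (p : R) (f h g : torus -> R[i]) : 1 <= p ->
  cmeasurable f -> cmeasurable h -> cmeasurable g ->
  (cLnorm p (f \- g)%R <=
   cLnorm p (f \- h)%R + cLnorm p (h \- g)%R)%E.
Proof.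
move=> p1 mf mh mg.
have m1 := measurable_cmod (cmeasurableB mf mh).
have m2 := measurable_cmod (cmeasurableB mh mg).
have m3 := measurable_cmod (cmeasurableB mf mg).
apply: le_trans (minkowski_EFin (torus_measure R d) m1 m2 p1).
have p0 : 0 <= p by rewrite (le_trans _ p1).
rewrite /cLnorm unlock; apply: gt0_ler_poweR; rewrite ?invr_ge0//.
- by rewrite in_itv/= integral_ge0 ?leey// => x _; exact: poweR_ge0.
- by rewrite in_itv/= integral_ge0 ?leey// => x _; exact: poweR_ge0.
have mp (u : torus -> R) : measurable_fun [set: torus] u ->
    measurable_fun [set: torus] (fun x => (`|(u x)%:E| `^ p)%E).
  move=> mu; rewrite (_ : (fun _ => _) = (fun x => (`|u x| `^ p)%:E)); last by [].
  apply/measurable_EFinP.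
  apply: (@measurableT_comp _ _ _ _ _ _ (@powR R ^~ p)) => //.
  exact: measurableT_comp.
apply: ge0_le_integral => //=.
- exact: mp.
- by apply: mp; exact: measurable_funD.
move=> x _; rewrite lee_fin ge0_ler_powR ?nnegrE//.
rewrite !ger0_norm ?addr_ge0 ?cmod_ge0//.
suff -> : f x - g x = f x - h x + (h x - g x) by exact: cmodD.
by rewrite addrA subrK.
Qed.

(* Elements are Borel functions of finite norm, not classes modulo a.e.
   equality: L_q is here the seminormed space of functions, with the
   (non-separated) topology of its seminorm. A set of functions is relatively
   compact for this topology iff its image in the quotient is. *)
Record Lspace (q : R) (q1 : 1 <= q) := LspaceFun {
  Lfun_val :> torus -> R[i];
  Lfun_meas : cmeasurable Lfun_val;
  Lfun_fin : (cLnorm q Lfun_val < +oo)%E }.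

Section Lspace_pseudometric.
Context (q : R) (q1 : 1 <= q).
Local Notation Lq := (Lspace q1).

HB.instance Definition _ := gen_eqMixin Lq.
HB.instance Definition _ := gen_choiceMixin Lq.

Definition Lball (f : Lq) (e : R) : set Lq :=
  [set g | (cLnorm q (f \- g)%R < e%:E)%E].

Let Lent := entourage_ Lball.
Let Lnbhs (f : Lq) : set_system Lq := nbhs_ Lent f.

HB.instance Definition _ := hasNbhs.Build Lq Lnbhs.

Let LnbhsE : nbhs = nbhs_ Lent. Proof. by []. Qed.

Let Lball_center f (e : R) : 0 < e -> Lball f e f.
Proof.
move=> e0; rewrite /Lball /cLnorm /=.
under eq_Lnorm do rewrite subrr cmod0.
by rewrite Lnorm0 ?lte_fin// eqe gt_eqF// (lt_le_trans _ q1).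
Qed.

Let Lball_sym (f g : Lq) (e : R) : Lball f e g -> Lball g e f.
Proof.
rewrite /Lball /cLnorm /=.
by under eq_Lnorm do rewrite -opprB cmodN.
Qed.

Let Lball_triangle (f g h : Lq) (e1 e2 : R) :
  Lball f e1 g -> Lball g e2 h -> Lball f (e1 + e2) h.
Proof.
move=> fg gh; rewrite /Lball/= EFinD.
apply: (le_lt_trans (cLnorm_triangle q1 (Lfun_meas f) (Lfun_meas g) (Lfun_meas h))).
exact: lteD.
Qed.

Let LentE : Lent = entourage_ Lball. Proof. by []. Qed.

HB.instance Definition _ := @Nbhs_isPseudoMetric.Build R Lq
  Lent LnbhsE Lball Lball_center Lball_sym Lball_triangle LentE.

End Lspace_pseudometric.
End Lebesgue_spaces.
Section distributions.
Context (R : realType) (d : nat).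
Local Notation test := (test_function R d).

(* Convergence in C^infinity of the torus: uniform convergence of all the
   derivatives. This topology is metrizable, so that sequential continuity of a
   linear functional is continuity. *)
Definition test_cvg (phi : nat -> test) (psi : test) := forall s : seq 'I_d,
  {uniform, (fun n => iter_pderiv s (fun x => complex.Re (phi n x))) @ \oo -->
            iter_pderiv s (fun x => complex.Re (psi x))} /\
  {uniform, (fun n => iter_pderiv s (fun x => complex.Im (phi n x))) @ \oo -->
            iter_pderiv s (fun x => complex.Im (psi x))}.

Record distribution := Distribution {
  dist_fun :> {linear test -> R[i]^o};
  dist_continuous : forall (phi : nat -> test) (psi : test),
    test_cvg phi psi -> (fun n => dist_fun (phi n)) @ \oo --> dist_fun psi }.

(* c_k(f) = (2 pi)^(-d) <f, e^(-i (k, .))> *)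
Definition Fourier_coef (f : distribution) (k : freq d) : R[i] :=
  ((2 * pi) ^- d)%:C%C * f (harmonic_test_function R (- k)).

Definition torus_point (x : torus R d) : 'rV[R]_d := \row_j tnth x j.

(* Bilinear pairing (no conjugation), <h, phi> = int_{T^d} h phi; a function h
   is identified with the distribution phi |-> <h, phi>. *)
Definition pairing (h : torus R d -> R[i]) (phi : test) : R[i] :=
  cintegral (fun x => h x * phi (torus_point x)).

Definition represents (h : torus R d -> R[i]) (f : distribution) :=
  forall phi : test, f phi = pairing h phi.

(* m |-> box_freq m is a bijection onto ([-N, N] cap Z)^d. *)
Definition box_freq (N : nat) (m : 'rV['I_N.*2.+1]_d) : freq d :=
  \row_j ((m ord0 j : nat)%:Z - N%:Z).

(* f = sum_k a(k) e^(i (k, .)) in the sense of distributions, the sum over Z^d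
   being the limit of the sums over the cubes ([-N, N] cap Z)^d. *)
Definition has_Fourier_series (f : distribution) (a : freq d -> R[i]) :=
  forall phi : test,
    (fun N => \sum_(m : 'rV['I_N.*2.+1]_d)
       a (box_freq m) *
       pairing (fun x => harmonic (box_freq m) (torus_point x)) phi : R[i]^o)
    @ \oo --> f phi.

(* The set of frequencies without zero coordinate. *)
Definition full_freq (k : freq d) : bool := [forall j, k ord0 j != 0].

Definition full_distribution : set distribution :=
  [set f | forall k, ~~ full_freq k -> Fourier_coef f k = 0].

(* (i m)^r = |m|^r e^(sgn(m) i pi r / 2), used for m <> 0 only *)
Definition ipow (m : int) (r : R) : R[i] :=
  (`|m%:~R| `^ r)%:C%C * expi ((sgz m)%:~R * pi * r / 2).

Definition is_Weyl_derivative (j : 'I_d) (r : R) (f g : distribution) :=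
  has_Fourier_series g (fun k =>
    if full_freq k then Fourier_coef f k * ipow (k ord0 j) r else 0).

(* The distribution g is (given by) a function of L_p-norm at most B. *)
Definition dist_Lnorm_le (p : R) (g : distribution) (B : \bar R) :=
  exists2 h : torus R d -> R[i],
    represents h g & cmeasurable h /\ (cLnorm p h <= B)%E.

Definition W_class (r p : 'I_d -> R) : set distribution :=
  [set f | full_distribution f /\
     forall j : 'I_d, exists2 g : distribution,
       is_Weyl_derivative j (r j) f g & dist_Lnorm_le (p j) g 1%E].

Definition compactly_embedded (q : R) (q1 : 1 <= q) (A : set distribution) :=
  (forall f, A f -> exists h : Lspace d q1, represents h f) /\
  precompact [set h : Lspace d q1 | exists2 f, A f & represents h f].

End distributions.

(* Main.v *)
From HB Require Import structures.
Require Import Defs.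
From mathcomp Require Import all_boot all_order all_algebra.
From mathcomp Require Import all_classical all_reals all_analysis.
From mathcomp Require Import measurable_realfun complex zify ring lra.

Set Implicit Arguments.
Unset Strict Implicit.
Unset Printing Implicit Defensive.
Import Order.TTheory GRing.Theory Num.Theory numFieldNormedType.Exports.
Local Open Scope classical_set_scope.
Local Open Scope ring_scope.

(** The hypothesis implies [sum_i (1/r_i) (1/p_i - 1/q) >= 1], because
    [p_j <= q]. Divide the numbers [b_i = (1/r_i) (1/p_i - 1/q) >= 0] by their
    sum: the quotients [a_i] add up to 1 and satisfy [a_i r_i <= 1/p_i - 1/q].
    For a large real number [T] consider

      [f_T = C^-1 T^(1/q - 1) prod_j D_(m_j)(x_j)],
      [D_m(x) = sum_(1 <= l <= m) e^(i l x)],  [m_j = floor(T^(a_j))].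

    The product of the degrees [m_j] is comparable to [T]. In one variable, the
    kernel [D_m] and its Weyl derivative of order [s], whose coefficients
    [l^s e^(i pi s / 2)] are monotone up to a unimodular factor, have size
    [m^(s+1)] on the arc [|x| <= 1/m] and decay like [m^s / |x|] away from it,
    by Abel summation ([kern_decay]). As [p > 1], their L_p norm is
    [O(m^(s + 1 - 1/p))] ([kern_Lp_bound]). Tensorizing, the derivative of [f_T]
    of order [r_i] in [x_i] has L_(p_i) norm at most a constant times
    [T^((1/q - 1) + a_i r_i + (1 - 1/p_i)) <= 1], so that a suitable constant
    [C] puts every [f_T] into the class ([Lp_extremal], [extremal_W_class]).

    On the other hand [|f_T| <= C^-1 T^(1/q)] everywhere, while
    [|f_T| >= delta C^-1 T^(1/q)] on the box [prod_j [0, 1/m_j]], whose measure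
    is at least [1/T]. If [T'] is much larger than [T], then on the box of [T']
    the function [f_T] is negligible compared with [f_T'], and
    [f_T' - f_T] has L_q norm bounded below by a constant
    ([extremal_separated]). Along a geometric sequence of parameters this
    gives an infinite uniformly separated subset of the class, which cannot be
    precompact ([not_precompact_separated]).

    Only trigonometric polynomials occur, so the distributional side reduces to
    two facts: a bounded measurable function defines a distribution
    ([fun_distribution]), and integrals over the torus of products of functions
    of separate variables factor ([cint_torus]), which gives the Fourier
    coefficients ([Fourier_coef_tensor]) and the norms
    ([Rintegral_tensor]). *)

(** * Bounded measurable functions *)

Section bounded_measurable.
Context (R : realType) {dT : measure_display} {T : measurableType dT}.
Implicit Types (f g : T -> R) (h k : T -> R[i]).

Definition bmeas f :=
  measurable_fun [set: T] f /\ exists B : R, forall x, `|f x| <= B.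

Lemma bmeas_cst (c : R) : bmeas (fun=> c).
Proof. by split; [exact: measurable_cst|exists `|c|]. Qed.

Lemma bmeasD f g : bmeas f -> bmeas g -> bmeas (fun x => f x + g x).
Proof.
move=> [mf [B fB]] [mg [C gC]]; split; first exact: measurable_funD.
by exists (B + C) => x; rewrite (le_trans (ler_normD _ _))// lerD.
Qed.

Lemma bmeasM f g : bmeas f -> bmeas g -> bmeas (fun x => f x * g x).
Proof.
move=> [mf [B fB]] [mg [C gC]]; split; first exact: measurable_funM.
by exists (B * C) => x; rewrite normrM ler_pM.
Qed.

Lemma bmeasN f : bmeas f -> bmeas (fun x => - f x).
Proof.
move=> [mf [B fB]]; split; first exact: measurableT_comp.
by exists B => x; rewrite normrN.
Qed.

Lemma bmeasB f g : bmeas f -> bmeas g -> bmeas (fun x => f x - g x).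
Proof. by move=> bf /bmeasN; exact: bmeasD. Qed.

Lemma bmeas_prod (I : finType) (F : I -> T -> R) :
  (forall i, bmeas (F i)) -> bmeas (fun x => \prod_i F i x).
Proof.
move=> bF; elim: (index_enum I) => [|i s ih].
  by under eq_fun do rewrite big_nil; exact: bmeas_cst.
by under eq_fun do rewrite big_cons; exact: bmeasM.
Qed.

Lemma bmeas_powR f (p : R) : 0 <= p -> bmeas f -> (forall x, 0 <= f x) ->
  bmeas (fun x => f x `^ p).
Proof.
move=> p0 [mf [B fB]] f0; split.
  exact: (measurableT_comp (measurable_powR p)).
exists (B `^ p) => x; rewrite ger0_norm ?powR_ge0// ge0_ler_powR ?nnegrE//.
  by rewrite (le_trans _ (fB x)).
by rewrite (le_trans (ler_norm _)).
Qed.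

Lemma bmeas_integrable_fin (mu : {measure set T -> \bar R}) f :
  (mu setT < +oo)%E -> bmeas f -> mu.-integrable [set: T] (EFin \o f).
Proof.
move=> muT [mf [B fB]]; apply: measurable_bounded_integrable => //.
by exists B; split; [exact: num_real|move=> C BC x _; exact: le_trans (fB x) (ltW BC)].
Qed.

Lemma bmeas_integrable (mu : {finite_measure set T -> \bar R}) f :
  bmeas f -> mu.-integrable [set: T] (EFin \o f).
Proof. by apply: bmeas_integrable_fin; rewrite ltey_eq fin_num_measure. Qed.

Definition cbmeas h :=
  bmeas (fun x => complex.Re (h x)) /\ bmeas (fun x => complex.Im (h x)).

Lemma cbmeas_cst (c : R[i]) : cbmeas (fun=> c).
Proof. by split; exact: bmeas_cst. Qed.

Lemma cbmeasD h k : cbmeas h -> cbmeas k -> cbmeas (fun x => h x + k x).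
Proof.
by move=> [h1 h2] [k1 k2]; split; [have := bmeasD h1 k1|have := bmeasD h2 k2];
  congr bmeas; apply/funext => x; case: (h x) (k x) => [? ?] [].
Qed.

Lemma cbmeasM h k : cbmeas h -> cbmeas k -> cbmeas (fun x => h x * k x).
Proof.
move=> [h1 h2] [k1 k2]; split;
  [have := bmeasB (bmeasM h1 k1) (bmeasM h2 k2)|
   have := bmeasD (bmeasM h1 k2) (bmeasM h2 k1)];
  by congr bmeas; apply/funext => x; case: (h x) (k x) => [? ?] [].
Qed.

Lemma cbmeas_sum (I : Type) (s : seq I) (P : pred I) (F : I -> T -> R[i]) :
  (forall i, cbmeas (F i)) -> cbmeas (fun x => \sum_(i <- s | P i) F i x).
Proof.
move=> bF; elim: s => [|i s ih].
  by under eq_fun do rewrite big_nil; exact: cbmeas_cst.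
under eq_fun do rewrite big_cons.
by case: (P i) => //; exact: cbmeasD.
Qed.

Lemma cbmeas_prod (I : Type) (s : seq I) (P : pred I) (F : I -> T -> R[i]) :
  (forall i, cbmeas (F i)) -> cbmeas (fun x => \prod_(i <- s | P i) F i x).
Proof.
move=> bF; elim: s => [|i s ih].
  by under eq_fun do rewrite big_nil; exact: cbmeas_cst.
under eq_fun do rewrite big_cons.
by case: (P i) => //; exact: cbmeasM.
Qed.

Lemma bmeas_cmod h : cbmeas h -> bmeas (fun x => cmod (h x)).
Proof.
move=> [[m1 [B hB]] [m2 [C hC]]]; split.
  rewrite (_ : (fun x => cmod (h x)) = (@Num.sqrt R) \o
    ((fun x => complex.Re (h x) ^+ 2) \+ (fun x => complex.Im (h x) ^+ 2))).
    apply: (measurableT_comp (continuous_measurable_fun (@sqrt_continuous R))).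
    by apply: measurable_funD; exact: measurable_funX.
  by apply/funext => x; rewrite /cmod /=; case: (h x).
exists (B + C) => x; rewrite ger0_norm ?cmod_ge0//.
have -> : h x = (complex.Re (h x))%:C%C + (0 +i* complex.Im (h x))%C.
  by case: (h x) => a b; rewrite /GRing.add/= addr0 add0r.
rewrite (le_trans (cmodD _ _))// lerD//.
  by rewrite /cmod/= expr0n addr0 sqrtr_sqr.
by rewrite /cmod/= expr0n add0r sqrtr_sqr.
Qed.

(** [cintegral] for an arbitrary measure: the torus, the circle and the products
    of both occur in the induction on the dimension. *)
Definition cint (mu : {measure set T -> \bar R}) h : R[i] :=
  (Rintegral mu setT (fun x => complex.Re (h x)) +i*
   Rintegral mu setT (fun x => complex.Im (h x)))%C.

Context (mu : {finite_measure set T -> \bar R}).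

Lemma cintD h k : cbmeas h -> cbmeas k ->
  cint mu (fun x => h x + k x) = cint mu h + cint mu k.
Proof.
move=> [h1 h2] [k1 k2]; rewrite /cint [RHS]/GRing.add/=; congr (_ +i* _)%C.
  rewrite -RintegralD//; [|exact: bmeas_integrable|exact: bmeas_integrable].
  by apply: eq_Rintegral => x _; case: (h x) (k x) => [? ?] [].
rewrite -RintegralD//; [|exact: bmeas_integrable|exact: bmeas_integrable].
by apply: eq_Rintegral => x _; case: (h x) (k x) => [? ?] [].
Qed.

Lemma cintZ (c : R[i]) h : cbmeas h ->
  cint mu (fun x => c * h x) = c * cint mu h.
Proof.
move=> [h1 h2]; case: c => a b; rewrite /cint [RHS]/GRing.mul/=.
have i1 := bmeas_integrable mu h1; have i2 := bmeas_integrable mu h2.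
have I u v : bmeas u -> mu.-integrable setT (EFin \o (fun x => v * u x)).
  by move=> bu; apply: bmeas_integrable; apply: bmeasM => //; exact: bmeas_cst.
congr (_ +i* _)%C; rewrite -!RintegralZl//.
  rewrite -RintegralB//; [|exact: I|exact: I].
  by apply: eq_Rintegral => x _; case: (h x).
rewrite -RintegralD//; [|exact: I|exact: I].
by apply: eq_Rintegral => x _; case: (h x).
Qed.

Lemma cint_sum (I : Type) (s : seq I) (F : I -> T -> R[i]) :
  (forall i, cbmeas (F i)) ->
  cint mu (fun x => \sum_(i <- s) F i x) = \sum_(i <- s) cint mu (F i).
Proof.
move=> bF; elim: s => [|i s ih].
  rewrite big_nil /cint; under eq_fun do rewrite big_nil.
  under [X in (_ +i* Rintegral _ _ X)%C]eq_fun do rewrite big_nil.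
  by rewrite /= !Rintegral_cst// !mul0r.
rewrite big_cons -ih -cintD//; last exact: cbmeas_sum.
by congr cint; apply/funext => x; rewrite big_cons.
Qed.

End bounded_measurable.

Lemma bmeas_comp (R : realType) d1 d2 (T1 : measurableType d1)
    (T2 : measurableType d2) (f : T2 -> R) (u : T1 -> T2) :
  bmeas f -> measurable_fun setT u -> bmeas (f \o u).
Proof.
by move=> [mf [B fB]] mu; split; [exact: measurableT_comp|exists B => x; exact: fB].
Qed.

Lemma cbmeas_comp (R : realType) d1 d2 (T1 : measurableType d1)
    (T2 : measurableType d2) (f : T2 -> R[i]) (u : T1 -> T2) :
  cbmeas f -> measurable_fun setT u -> cbmeas (f \o u).
Proof.
by move=> [f1 f2] mu; split;
  [exact: (bmeas_comp f1 mu)|exact: (bmeas_comp f2 mu)].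
Qed.

(** * Integrals of products of functions of separate variables *)

Section product_integrals.
Context (R : realType).
Local Notation mR := (measurableTypeR R).

Lemma bmeas_integrable_prod d1 d2 (T1 : measurableType d1) (T2 : measurableType d2)
    (m1 : {finite_measure set T1 -> \bar R})
    (m2 : {finite_measure set T2 -> \bar R}) (f : T1 * T2 -> R) :
  bmeas f -> (m1 \x m2)%E.-integrable setT (EFin \o f).
Proof.
apply: bmeas_integrable_fin.
suff : ((m1 \x m2)%E ([set: T1] `*` [set: T2]) < +oo)%E by rewrite setXTT.
rewrite product_measure1E//.
by rewrite lte_mul_pinfty ?fin_num_measure// ltey_eq fin_num_measure.
Qed.

Lemma Rintegral_prod d1 d2 (T1 : measurableType d1) (T2 : measurableType d2)
    (m1 : {finite_measure set T1 -> \bar R})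
    (m2 : {finite_measure set T2 -> \bar R}) (u : T1 -> R) (v : T2 -> R) :
  bmeas u -> bmeas v ->
  Rintegral (m1 \x m2)%E setT (fun z => u z.1 * v z.2) =
  Rintegral m1 setT u * Rintegral m2 setT v.
Proof.
move=> bu bv.
have iu := bmeas_integrable m1 bu; have iv := bmeas_integrable m2 bv.
have ib : (m1 \x m2)%E.-integrable setT (EFin \o (fun z => u z.1 * v z.2)).
  apply: (@bmeas_integrable_prod _ _ _ _ m1 m2 (fun z => u z.1 * v z.2)).
  by apply: bmeasM; [exact: (bmeas_comp bu)|exact: (bmeas_comp bv)].
rewrite /Rintegral -integral12_prod_meas1//.
rewrite /fubini_F/=.
transitivity (fine (\int[m1]_x ((Rintegral m2 setT v)%:E * (u x)%:E)%E)%E).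
  congr fine; apply: eq_integral => x _.
  under eq_integral do rewrite EFinM.
  rewrite integralZl// muleC; congr (_ * _)%E.
  by rewrite /Rintegral fineK//; exact: integrable_fin_num.
rewrite integralZl// fineM//; last exact: integrable_fin_num.
by rewrite mulrC.
Qed.

Lemma cint_prod d1 d2 (T1 : measurableType d1) (T2 : measurableType d2)
    (m1 : {finite_measure set T1 -> \bar R})
    (m2 : {finite_measure set T2 -> \bar R}) (u : T1 -> R[i]) (v : T2 -> R[i]) :
  cbmeas u -> cbmeas v ->
  cint (m1 \x m2)%E (fun z => u z.1 * v z.2) = cint m1 u * cint m2 v.
Proof.
move=> [u1 u2] [v1 v2].
have I (a : T1 -> R) (b : T2 -> R) : bmeas a -> bmeas b ->
    (m1 \x m2)%E.-integrable setT (EFin \o (fun z => a z.1 * b z.2)).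
  move=> ba bb.
  apply: (@bmeas_integrable_prod _ _ _ _ m1 m2 (fun z => a z.1 * b z.2)).
  by apply: bmeasM; [exact: (bmeas_comp ba)|exact: (bmeas_comp bb)].
rewrite /cint [RHS]/GRing.mul/=; congr (_ +i* _)%C; rewrite -!Rintegral_prod//.
  rewrite -RintegralB//; [|exact: (I _ _ u1 v1)|exact: (I _ _ u2 v2)].
  by apply: eq_Rintegral => z _; case: (u z.1) (v z.2) => [? ?] [].
rewrite -RintegralD//; [|exact: (I _ _ u1 v2)|exact: (I _ _ u2 v1)].
by apply: eq_Rintegral => z _; case: (u z.1) (v z.2) => [? ?] [].
Qed.

(** The recursion that defines the torus measure, read on integrals. *)
Lemma cint_tcons n (h : n.+1.-tuple mR -> R[i]) : cbmeas h ->
  cint (torus_measure R n.+1) h =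
  cint (circle_measure (R:=R) \x torus_measure R n)%E (h \o @tcons R n).
Proof.
have E (f : n.+1.-tuple mR -> R) : bmeas f ->
    Rintegral (torus_measure R n.+1) setT f =
    Rintegral (circle_measure (R:=R) \x torus_measure R n)%E setT (f \o @tcons R n).
  move=> bf; rewrite /Rintegral; congr fine.
  rewrite [LHS](@integral_pushforward _ _ _ _ _ (@tcons R n) (@measurable_tcons R n)
     (circle_measure (R:=R) \x torus_measure R n)%E setT (EFin \o f))//.
    by apply/measurable_EFinP; exact: bf.1.
  apply: bmeas_integrable_prod.
  exact: (bmeas_comp bf (@measurable_tcons R n)).
by move=> [h1 h2]; rewrite /cint !E.
Qed.

Lemma cint_torus n (g : 'I_n -> mR -> R[i]) : (forall j, cbmeas (g j)) ->
  cint (torus_measure R n) (fun x => \prod_(j < n) g j (tnth x j)) =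
  \prod_(j < n) cint (circle_measure (R:=R)) (g j).
Proof.
elim: n g => [|n ih] g bg.
  rewrite big_ord0 /cint /Rintegral.
  rewrite !integral_dirac//; last first.
  - by apply/measurable_EFinP; under eq_fun do rewrite big_ord0; exact: measurable_cst.
  - by apply/measurable_EFinP; under eq_fun do rewrite big_ord0; exact: measurable_cst.
  by rewrite diracT !mul1e !big_ord0.
rewrite cint_tcons; last first.
  apply: cbmeas_prod => j.
  exact: (cbmeas_comp (bg j) (@measurable_tnth _ _ _ j)).
rewrite big_ord_recl -ih//.
rewrite -cint_prod//; last first.
  apply: cbmeas_prod => j.
  exact: (cbmeas_comp (bg _) (@measurable_tnth _ _ _ j)).
congr cint; apply/funext => z /=.
rewrite big_ord_recl; congr (_ * _); apply: eq_bigr => j _.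
by rewrite /tcons tnthS.
Qed.

Lemma cint_real d (T : measurableType d) (mu : {measure set T -> \bar R}) (f : T -> R) :
  cint mu (fun x => (f x)%:C%C) = (Rintegral mu setT f)%:C%C.
Proof.
rewrite /cint/=; congr (_ +i* _)%C.
by rewrite Rintegral_cst// mul0r.
Qed.

Lemma Rintegral_torus n (g : 'I_n -> mR -> R) : (forall j, bmeas (g j)) ->
  Rintegral (torus_measure R n) setT (fun x => \prod_(j < n) g j (tnth x j)) =
  \prod_(j < n) Rintegral (circle_measure (R:=R)) setT (g j).
Proof.
move=> bg; have := @cint_torus n (fun j x => (g j x)%:C%C).
have E x : \prod_(j < n) (g j (tnth x j))%:C%C = (\prod_(j < n) g j (tnth x j))%:C%C.
  by rewrite rmorph_prod.
under eq_fun do rewrite E.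
rewrite cint_real; under [in RHS]eq_bigr do rewrite cint_real.
rewrite -rmorph_prod => H; apply: complexI; apply: H => j.
by split; [exact: bg|exact: (bmeas_cst 0)].
Qed.

End product_integrals.

(** * Integration over the circle *)

Section circle.
Context (R : realType).
Local Notation mR := (measurableTypeR R).
Local Notation leb := (@lebesgue_measure R).
Local Notation circ := (circle_measure (R:=R)).

Lemma twopi_gt0 : 0 < 2 * pi :> R.
Proof. by rewrite mulr_gt0// pi_gt0. Qed.

Lemma Rintegral_circle (f : mR -> R) : bmeas f ->
  Rintegral circ setT f = Rintegral leb `[0, 2 * pi] f.
Proof.
move=> bf; rewrite /Rintegral; congr fine.
rewrite (@negligible_integral _ _ _ circ setT (~` `[0, 2 * pi]))//.
- rewrite setTD setCK; apply: eq_measure_integral => A mA AI.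
  rewrite [LHS](_ : _ = leb (A `&` `[0, 2 * pi]))//.
  by congr (lebesgue_measure _); apply: setIidl.
- by apply: measurableC; exact: measurable_itv.
- exact: bmeas_integrable.
rewrite [LHS](_ : _ = leb (~` `[0, 2 * pi] `&` `[0, 2 * pi]))//.
by rewrite setICl measure0.
Qed.

Lemma Rintegral_circle_indic (a : R) : 0 <= a <= 2 * pi ->
  Rintegral circ setT (\1_`[0, a]) = a.
Proof.
move=> /andP[a0 a2]; rewrite /Rintegral integral_indic ?setIT//.
  rewrite [X in fine X](_ : _ = leb (`[0, a] `&` `[0, 2 * pi])); last first.
    by congr (lebesgue_measure (_ `&` _)).
  rewrite setIidl; last first.
    by move=> x; rewrite /= !in_itv/= => /andP[-> xa]; rewrite (le_trans xa).
  rewrite lebesgue_measure_itv/= lte_fin.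
  by case: ltgtP a0 => // _ _; rewrite /= subr0. 
Qed.

Lemma bmeas_circle_integrable (f : mR -> R) : bmeas f ->
  leb.-integrable `[0, 2 * pi] (EFin \o f).
Proof.
move=> [mf [B fB]]; apply: measurable_bounded_integrable => //.
- suff : (leb `[0%R, (2 * pi)%R]%classic < +oo)%E by []. 
  by rewrite lebesgue_measure_itv/=; case: ifPn; rewrite ?ltry.
- exact: measurable_funTS.
- by exists B; split; [exact: num_real|move=> C BC x _; exact: le_trans (fB x) (ltW BC)].
Qed.

End circle.

(** * Trigonometric polynomials in one variable *)

Section cmod.
Context (R : realType).
Implicit Types (z w : R[i]).

Lemma cmodM z w : cmod (z * w) = cmod z * cmod w.
Proof. exact: ComplexField.Normc.normcM. Qed.

Lemma cmod1 : cmod (1 : R[i]) = 1.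
Proof. exact: ComplexField.Normc.normc1. Qed.

Lemma cmodB z w : cmod z - cmod w <= cmod (z - w).
Proof. by rewrite lerBlDr -{1}(subrK w z) cmodD. Qed.

Lemma cmod_real (a : R) : cmod a%:C%C = `|a|.
Proof. by rewrite /cmod/= expr0n addr0 sqrtr_sqr. Qed.

Lemma cmod_sum (I : Type) (s : seq I) (P : pred I) (F : I -> R[i]) :
  cmod (\sum_(i <- s | P i) F i) <= \sum_(i <- s | P i) cmod (F i).
Proof.
elim/big_rec2 : _ => [|i y x _ xy]; first by rewrite cmod0.
by rewrite (le_trans (cmodD _ _))// lerD2l.
Qed.

Lemma cmod_prod (I : Type) (s : seq I) (P : pred I) (F : I -> R[i]) :
  cmod (\prod_(i <- s | P i) F i) = \prod_(i <- s | P i) cmod (F i).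
Proof. by elim/big_rec2 : _ => [|i y x _ <-]; [exact: cmod1|exact: cmodM]. Qed.

Lemma Re_le_cmod z : complex.Re z <= cmod z.
Proof.
rewrite (le_trans (ler_norm _))// -lecR cmodE; exact: normc_ge_Re.
Qed.

Lemma expi0 : expi (0 : R) = 1.
Proof. by rewrite /expi cos0 sin0. Qed.

Lemma expiD (s t : R) : expi (s + t) = expi s * expi t.
Proof.
by rewrite /expi cosD sinD [RHS]/GRing.mul/= [sin s * cos t + _]addrC.
Qed.

Lemma expi_sum (I : Type) (s : seq I) (F : I -> R) :
  expi (\sum_(i <- s) F i) = \prod_(i <- s) expi (F i).
Proof.
by elim/big_rec2 : _ => [|i y x _ <-]; [exact: expi0|exact: expiD].
Qed.

Lemma cmod_expi (t : R) : cmod (expi t) = 1.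
Proof. by rewrite /cmod/= cos2Dsin2 sqrtr1. Qed.

Lemma cbmeas_expi (c : R) :
  cbmeas (fun x : measurableTypeR R => expi (c * x)).
Proof.
split; split.
- apply: continuous_measurable_fun => x; apply: continuous_comp.
    by apply: mulrl_continuous.
  exact: continuous_cos.
- by exists 1 => x /=; rewrite ler_norml cos_geN1 cos_le1.
- apply: continuous_measurable_fun => x; apply: continuous_comp.
    by apply: mulrl_continuous.
  exact: continuous_sin.
- by exists 1 => x /=; rewrite ler_norml sin_geN1 sin_le1.
Qed.

End cmod.

Section orthogonality.
Context (R : realType).
Local Notation mR := (measurableTypeR R).
Local Notation leb := (@lebesgue_measure R).
Local Notation circ := (circle_measure (R:=R)).

Lemma sin_int2pi (k : int) : sin (k%:~R * (2 * pi)) = 0 :> R.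
Proof.
have E n : sin (n%:R * (2 * pi)) = 0 :> R.
  rewrite mulr_natl [2 * pi]mulr_natl -[_ *+ n]add0r.
  by rewrite (periodicn (@sinD2pi R)) sin0.
by case: k => n; rewrite ?NegzE ?mulrNz ?mulNr ?sinN E ?oppr0.
Qed.

Lemma cos_int2pi (k : int) : cos (k%:~R * (2 * pi)) = 1 :> R.
Proof.
have E n : cos (n%:R * (2 * pi)) = 1 :> R.
  rewrite mulr_natl [2 * pi]mulr_natl -[_ *+ n]add0r.
  by rewrite (periodicn (@cosD2pi R)) cos0.
by case: k => n; rewrite ?NegzE ?mulrNz ?mulNr ?cosN E.
Qed.

Lemma Rintegral_FTC2 (F f : R -> R) (a b : R) : a < b ->
  (forall x, x \in `[a, b] -> is_derive x 1 F (f x)) ->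
  (forall x, x \in `[a, b] -> {for x, continuous f}) ->
  Rintegral leb `[a, b] f = F b - F a.
Proof.
move=> ab dF cf.
have cF x : x \in `[a, b] -> {for x, continuous F}.
  move=> xab; apply/differentiable_continuous/derivable1_diffP.
  by have [] := dF _ xab.
have [aI bI] : (a \in `[a, b]) /\ (b \in `[a, b]).
  by rewrite !in_itv/= !lexx ltW.
rewrite /Rintegral (@continuous_FTC2 _ _ F)//.
- by apply: continuous_in_subspaceT => x /[!inE] xab; exact: cf.
- split.
  + move=> x xab; have [] // := dF x (subset_itv_oo_cc xab).
  + by apply: cvg_at_right_filter; exact: cF.
  + by apply: cvg_at_left_filter; exact: cF.
- move=> x xab; rewrite derive1E.
  by have [_ ->] := dF x (subset_itv_oo_cc xab).
Qed.

Lemma cint_circle_expi (k : int) :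
  cint circ (fun x => expi (k%:~R * x)) = if k == 0 then (2 * pi)%:C%C else 0.
Proof.
have [br bi] := cbmeas_expi (k%:~R : R).
rewrite /cint (Rintegral_circle br) (Rintegral_circle bi) /=.
have [->|k0] := eqVneq k 0.
  under eq_Rintegral do rewrite mul0r cos0.
  under [X in (_ +i* X)%C]eq_Rintegral do rewrite mul0r sin0.
  rewrite !Rintegral_cst//= lebesgue_measure_itv/= lte_fin twopi_gt0/=.
  by rewrite subr0 mul1r mul0r.
have kR : (k%:~R : R) != 0 by rewrite intr_eq0.
have ck (x : R) : {for x, continuous (fun y : R => k%:~R * y : R)} by exact: mulrl_continuous.
congr (_ +i* _)%C.
  transitivity ((k%:~R)^-1 * sin (k%:~R * (2 * pi)) - (k%:~R)^-1 * sin (k%:~R * 0) : R).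
    apply: (@Rintegral_FTC2 (fun x => (k%:~R)^-1 * sin (k%:~R * x))).
    - exact: twopi_gt0.
    - by move=> x _; apply: is_derive_eq; rewrite /GRing.scale/=; field.
    - by move=> x _; apply: continuous_comp; [exact: ck|exact: continuous_cos].
  by rewrite sin_int2pi !mulr0 sin0 mulr0 subr0.
transitivity (- ((k%:~R)^-1 * cos (k%:~R * (2 * pi))) - (- ((k%:~R)^-1 * cos (k%:~R * 0))) : R).
  apply: (@Rintegral_FTC2 (fun x => - ((k%:~R)^-1 * cos (k%:~R * x)))).
  - exact: twopi_gt0.
  - by move=> x _; apply: is_derive_eq; rewrite /GRing.scale/=; field.
  - by move=> x _; apply: continuous_comp; [exact: ck|exact: continuous_sin].
by rewrite cos_int2pi mulr0 cos0 mulr1 opprK addNr.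
Qed.

End orthogonality.

Section kernel.
Context (R : realType).
Local Notation mR := (measurableTypeR R).
Local Notation leb := (@lebesgue_measure R).
Local Notation circ := (circle_measure (R:=R)).

(** The Weyl derivative of order [s] of [sum_(1 <= l <= m) e^(i l x)]; [s = 0]
    gives the sum itself. Keeping the frequencies positive avoids the frequency
    0 and makes the coefficients monotone up to a common unimodular factor. *)
Definition kern (m : nat) (s : R) (x : mR) : R[i] :=
  \sum_(1 <= l < m.+1) ipow l%:Z s * expi ((l%:Z)%:~R * x).

Lemma cbmeas_kern m s : cbmeas (kern m s).
Proof.
apply: cbmeas_sum => l; apply: cbmeasM; first exact: cbmeas_cst.
exact: cbmeas_expi.
Qed.

Lemma cmod_ipow (l : nat) (s : R) : cmod (ipow l%:Z s) = l%:R `^ s.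
Proof.
by rewrite /ipow cmodM cmod_real cmod_expi mulr1 ger0_norm ?powR_ge0// ger0_norm.
Qed.

Lemma ipow0r (k : int) : ipow k (0 : R) = 1.
Proof. by rewrite /ipow powRr0 mulr0 mul0r expi0 mulr1. Qed.

Lemma cmod_kern_le m s x : 0 <= s -> cmod (kern m s x) <= m%:R * m%:R `^ s.
Proof.
move=> s0; rewrite (le_trans (cmod_sum _ _ _))//.
rewrite (@le_trans _ _ (\sum_(1 <= l < m.+1) m%:R `^ s))//.
  rewrite !big_nat; apply: ler_sum => l /andP[l1 lm].
  rewrite cmodM cmod_expi mulr1 cmod_ipow ge0_ler_powR ?nnegrE//.
  by rewrite ler_nat -ltnS.
by rewrite sumr_const_nat subn1 mulr_natl. 
Qed.

(** For [x <= 1/m] all the terms have argument at most 1, so that their real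
    parts do not cancel. *)
Lemma cmod_kern0_ge m x : 0 <= x -> m%:R * x <= 1 ->
  m%:R * cos 1 <= cmod (kern m 0 x).
Proof.
move=> x0 mx1; apply: le_trans (Re_le_cmod _).
have -> : complex.Re (kern m 0 x) = \sum_(1 <= l < m.+1) cos (l%:R * x).
  rewrite /kern; elim/big_rec2 : _ => // l y z _ <-.
  by rewrite ipow0r mul1r; case: z.
rewrite (@le_trans _ _ (\sum_(1 <= l < m.+1) cos 1))//.
  by rewrite sumr_const_nat subn1 mulr_natl.
rewrite !big_nat; apply: ler_sum => l /andP[l1 lm].
have lx1 : l%:R * x <= 1.
  by rewrite (le_trans _ mx1)// ler_wpM2r// ler_nat -ltnS.
have pi1 : 1 <= pi :> R by rewrite (le_trans _ (pi_ge2 R))// ler1n.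
rewrite leNgt ltr_cos ?in_itv/= ?ler01 ?pi1//; first by rewrite -leNgt.
by rewrite mulr_ge0//= (le_trans lx1).
Qed.

(** Summation by parts: [(1 - z) sum_l a_l z^l] telescopes into the increments of
    [a], which are nonnegative and add up to at most [a m], and a last term of
    modulus [a m]. *)
Lemma Abel_bound (a : nat -> R) (z : R[i]) m : cmod z = 1 -> 0 <= a 0%N ->
  (forall l, a l <= a l.+1) ->
  cmod ((1 - z) * \sum_(1 <= l < m.+1) (a l)%:C%C * z ^+ l) <= 2 * a m.
Proof.
move=> z1 a0 am.
have zX n : cmod (z ^+ n) = 1.
  by elim: n => [|n ih]; rewrite ?expr0 ?cmod1// exprS cmodM z1 ih mulr1.
have H : cmod ((1 - z) * (\sum_(1 <= l < m.+1) (a l)%:C%C * z ^+ l) +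
    (a m)%:C%C * z ^+ m.+1) <= a m.
  elim: m => [|m ih].
    by rewrite big_nil mulr0 add0r cmodM zX mulr1 cmod_real ger0_norm.
  rewrite big_nat_recr//= (_ : _ + _ =
    (1 - z) * (\sum_(1 <= l < m.+1) (a l)%:C%C * z ^+ l) + (a m)%:C%C * z ^+ m.+1
     + (a m.+1 - a m)%:C%C * z ^+ m.+1); last first.
    by rewrite rmorphB/= [z ^+ m.+2]exprS; ring.
  rewrite (le_trans (cmodD _ _))// cmodM zX mulr1 cmod_real.
  by rewrite ger0_norm ?subr_ge0//; lra.
have -> : (1 - z) * (\sum_(1 <= l < m.+1) (a l)%:C%C * z ^+ l) =
  ((1 - z) * (\sum_(1 <= l < m.+1) (a l)%:C%C * z ^+ l) +
    (a m)%:C%C * z ^+ m.+1) - (a m)%:C%C * z ^+ m.+1 by rewrite addrK.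
have am0 : 0 <= a m by elim: m {H} => // m /le_trans; apply.
rewrite (le_trans (cmodD _ _))// cmodN [cmod (_ * z ^+ _)]cmodM zX mulr1 cmod_real.
by rewrite ger0_norm//; lra.
Qed.

Lemma expiX (x : R) n : expi (n%:R * x) = expi x ^+ n.
Proof.
elim: n => [|n ih]; first by rewrite mul0r expi0.
by rewrite exprS -ih -expiD -[in LHS]natr1 mulrDl mul1r addrC.
Qed.

Lemma kernE m s x :
  kern m s x = expi (pi * s / 2) *
    \sum_(1 <= l < m.+1) (l%:R `^ s)%:C%C * expi x ^+ l.
Proof.
rewrite /kern mulr_sumr !big_nat; apply: eq_bigr => -[|l]// _.
by rewrite /ipow mul1r ger0_norm// mulrCA mulrA -expiX.
Qed.

Lemma kern_Abel m s x : 0 <= s ->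
  cmod (1 - expi x) * cmod (kern m s x) <= 2 * m%:R `^ s.
Proof.
move=> s0; rewrite kernE cmodM cmod_expi mul1r -cmodM.
apply: (@Abel_bound (fun l => l%:R `^ s)); first exact: cmod_expi.
  exact: powR_ge0.
by move=> l; rewrite ge0_ler_powR ?nnegrE// ler_nat.
Qed.

Lemma sin_ge_cos1 (y : R) : 0 <= y <= 1 -> cos 1 * y <= sin y.
Proof.
move=> /andP[y0 y1].
have [|c cy] := @MVT_segment R sin cos 0 y y0 (fun x _ => is_derive_sin x).
- by apply: continuous_subspaceT; exact: continuous_sin.
rewrite sin0 !subr0 => ->; rewrite ler_wpM2r//.
have pi1 : 1 <= pi :> R by rewrite (le_trans _ (pi_ge2 R))// ler1n.
move: cy; rewrite in_itv/= => /andP[c0 cy].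
rewrite leNgt ltr_cos ?in_itv/= ?ler01 ?pi1 ?c0//=; last lra.
by rewrite -leNgt; lra.
Qed.

Lemma cmod_1Bexpi (x : R) : 0 <= x <= 2 * pi ->
  cmod (1 - expi x) = 2 * sin (x / 2).
Proof.
move=> /andP[x0 x2].
have s0 : 0 <= sin (x / 2) by apply: sin_ge0_pi; apply/andP; split; lra.
rewrite -[RHS]ger0_norm ?mulr_ge0// -sqrtr_sqr /cmod/=; congr Num.sqrt.
set y := x / 2; have -> : x = y *+ 2 by rewrite mulr2n -splitr.
rewrite cos_mulr2n sin_mulr2n.
have := cos2Dsin2 y; move: (cos _) (sin _) => c s; rewrite !mulr2n => cs.
have -> : c ^+ 2 = 1 - s ^+ 2 by rewrite -cs; ring.
have -> : (0 - (c * s + c * s)) ^+ 2 = 4 * c ^+ 2 * s ^+ 2 by ring.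
have -> : c ^+ 2 = 1 - s ^+ 2 by rewrite -cs; ring.
ring.
Qed.

(** A weak Jordan inequality: the double angle formula reduces it to the arc
    [[0, pi / 4]], contained in [[0, 1]], where [cos] is at least [cos 1]. *)
Lemma sin_half_ge (x : R) : 0 <= x <= pi -> cos 1 ^+ 2 * x <= 2 * sin (x / 2).
Proof.
move=> /andP[x0 xpi].
have x41 : 0 <= x / 4 <= 1 by have p2 := pihalf_lt2 R; apply/andP; split; lra.
have -> : x / 2 = x / 4 *+ 2 by rewrite -mulr_natr; field.
rewrite sin_mulr2n.
have h1 := sin_ge_cos1 x41.
have h2 : cos 1 <= cos (x / 4).
  case/andP: x41 => a b; have pi1 := pi_ge2 R.
  rewrite leNgt ltr_cos ?in_itv/=; first by rewrite -leNgt.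
    by apply/andP; split; lra.
  by apply/andP; split; lra.
have c0 := cos1_gt0 R.
rewrite (_ : _ * x = (cos 1 * (cos 1 * (x / 4)) *+ 2) * 2); last by rewrite mulr2n; field.
rewrite [2 * _]mulrC ler_wpM2r// ler_wMn2r// ler_pM// ?mulr_ge0//; first exact: ltW.
  exact: ltW.
Qed.

(** The summand 1 pays for the bound [m * m^s] near the origin and
    [2 / cos 1 ^+ 2] for the decay given by Abel summation. *)
Definition kernC : R := 1 + 2 / cos 1 ^+ 2.

Lemma kernC_ge1 : 1 <= kernC.
Proof. by rewrite lerDl divr_ge0// exprn_ge0// ltW// cos1_gt0. Qed.

(** The trivial bound and the Abel bound combined in one denominator, which is
    bounded away from 0 and therefore easy to integrate. *)
Lemma kern_decay m s x : (0 < m)%N -> 0 <= s -> 0 <= x <= 2 * pi ->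
  cmod (kern m s x) * (Num.min x (2 * pi - x) + m%:R^-1) <= kernC * m%:R `^ s.
Proof.
move=> m0 s0 x2pi; set y := Num.min _ _.
have c2 : 0 < cos 1 ^+ 2 :> R by rewrite exprn_gt0// cos1_gt0.
have yI : 0 <= y <= pi.
  by case/andP: x2pi => a b; rewrite /y; case: (leP x (2 * pi - x)) => h; apply/andP; split; lra.
have : cos 1 ^+ 2 * y <= cmod (1 - expi x).
  rewrite cmod_1Bexpi//; have := sin_half_ge yI.
  rewrite /y; case: (leP x (2 * pi - x)) => // h.
  suff -> : sin ((2 * pi - x) / 2) = sin (x / 2) by [].
  have -> : (2 * pi - x) / 2 = - (x / 2) + pi by lra.
  by rewrite sinDpi sinN opprK.
move=> h; have := kern_Abel m x s0.
have := cmod_kern_le m x s0.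
set K := cmod (kern m s x); set a := m%:R `^ s => h1 h2.
have K0 : 0 <= K by exact: cmod_ge0.
have h3 : cos 1 ^+ 2 * (K * y) <= 2 * a.
  by apply: le_trans h2; rewrite mulrCA mulrC ler_wpM2r// cmod_ge0.
rewrite mulrDr /kernC mulrDl addrC mul1r lerD//.
  by rewrite ler_pdivrMr ?ltr0n// mulrC.
by rewrite mulrAC ler_pdivlMr// mulrC.
Qed.

Lemma Rintegral_affine_powR (e c p : R) : e != 0 -> 1 < p ->
  (forall x, 0 <= x <= 2 * pi -> 0 < e * x + c) ->
  leb.-integrable `[0, 2 * pi] (EFin \o (fun x => (e * x + c) `^ (- p))) /\
  Rintegral leb `[0, 2 * pi] (fun x => (e * x + c) `^ (- p)) =
    (c `^ (1 - p) - (e * (2 * pi) + c) `^ (1 - p)) / (e * (p - 1)).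
Proof.
move=> e0 p1 ec.
have p0 : p - 1 != 0 by rewrite subr_eq0 gt_eqF.
have p0' : 1 - p != 0 by rewrite subr_eq0 lt_eqF.
have D (r x : R) : x \in `[0, 2 * pi] ->
    is_derive x 1 (fun x => (e * x + c) `^ r) (e * (r * (e * x + c) `^ (r - 1))).
  rewrite in_itv/= => xI.
  have H : is_derive (e * x + c) 1 (@powR R ^~ r) (r * (e * x + c) `^ (r - 1)).
    by apply: is_derive1_powR; exact: ec.
  have H2 : is_derive x 1 (fun x => e * x + c) e.
    by apply: is_derive_eq; rewrite /GRing.scale/=; ring.
  by have := @is_derive1_comp _ (@powR R ^~ r) (fun x => e * x + c) x _ _ H H2; rewrite [_ * e]mulrC.
have C (r x : R) : x \in `[0, 2 * pi] -> {for x, continuous (fun x => (e * x + c) `^ r)}.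
  move=> xI; apply/differentiable_continuous/derivable1_diffP.
  by have [] := D r _ xI.
split.
  apply: continuous_compact_integrable; first exact: segment_compact.
  by apply: continuous_in_subspaceT => x /[!inE] xab; exact: C.
transitivity ((e * (1 - p))^-1 * (e * (2 * pi) + c) `^ (1 - p) -
   (e * (1 - p))^-1 * (e * 0 + c) `^ (1 - p)).
  apply: (@Rintegral_FTC2 _ (fun x => (e * (1 - p))^-1 * (e * x + c) `^ (1 - p))).
  - exact: twopi_gt0.
  - move=> x xI; have dx := D (1 - p) x xI.
    apply: is_derive_eq; rewrite /GRing.scale/= ?mulr0 ?addr0.
    have -> : 1 - p - 1 = - p by ring.
    by field; rewrite e0 p0'.
  - by move=> x; exact: C.
rewrite mulr0 add0r; field; by rewrite e0 p0.
Qed.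

(** [2 / (p - 1)] comes from integrating [(x + 1/m)^(-p)] from both ends of the
    period; the summand 1 makes the powers of the constant monotone. *)
Definition kern_const (p : R) : R := 1 + kernC `^ p * (2 / (p - 1)).

Lemma kern_const_ge1 p : 1 < p -> 1 <= kern_const p.
Proof.
move=> p1; rewrite lerDl mulr_ge0 ?powR_ge0// divr_ge0// subr_ge0.
exact: ltW.
Qed.

(** This is where [p > 1] matters: the tail of [x^(-p)] beyond [1/m] is then
    comparable to its part near [1/m], namely to [m^(p - 1)], without a
    logarithm. *)
Lemma kern_Lp_bound m s p : (0 < m)%N -> 0 <= s -> 1 < p ->
  Rintegral circ setT (fun x => cmod (kern m s x) `^ p) <=
  kern_const p * ((m%:R `^ s) `^ p * m%:R `^ (p - 1)).
Proof.
move=> m0 s0 p1.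
have p0 : 0 <= p by rewrite (le_trans ler01)// ltW.
have m0R : (0 : R) < m%:R by rewrite ltr0n.
have mV0 : (0 : R) < m%:R^-1 by rewrite invr_gt0.
have bK : bmeas (fun x : mR => cmod (kern m s x) `^ p).
  by apply: bmeas_powR => //; [exact: bmeas_cmod (cbmeas_kern _ _)|move=> x; exact: cmod_ge0].
rewrite Rintegral_circle//.
have [i1 E1] := @Rintegral_affine_powR 1 m%:R^-1 p (oner_neq0 _) p1
   (fun x xI => ltac:(case/andP: xI => a b; lra)).
have N1 : (-1 : R) != 0 by rewrite oppr_eq0 oner_neq0.
have [i2 E2] := @Rintegral_affine_powR (-1) (2 * pi + m%:R^-1) p N1 p1
   (fun x xI => ltac:(case/andP: xI => a b; lra)).
set g1 := (fun x : R => (1 * x + m%:R^-1) `^ (- p)) in i1 E1.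
set g2 := (fun x : R => (-1 * x + (2 * pi + m%:R^-1)) `^ (- p)) in i2 E2.
set C := (kernC * m%:R `^ s) `^ p.
have mI : measurable (`[0, 2 * pi]%classic : set mR) by exact: measurable_itv.
have i12 : leb.-integrable `[0, 2 * pi] (EFin \o (fun x => g1 x + g2 x)).
  exact: (integrableD mI i1 i2).
(* The distance to the nearest end of the period is replaced by the sum over
   both ends. *)
apply: (@le_trans _ _ (Rintegral leb `[0, 2 * pi] (fun x => C * (g1 x + g2 x)))).
  apply: le_Rintegral => //.
  - exact: bmeas_circle_integrable.
  - exact: (integrableZl mI C i12).
  move=> x; rewrite /= in_itv/= => xI.
  have := kern_decay m0 s0 xI.
  set y := Num.min _ _; set K := cmod _ => h.
  have yV : 0 < y + m%:R^-1.
    case/andP: xI => a b; rewrite /y; case: (leP x (2 * pi - x)) => h'; lra.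
  have Kle : K `^ p <= C * (y + m%:R^-1) `^ (- p).
    rewrite powRN ler_pdivlMr ?powR_gt0// -powRM ?cmod_ge0 ?(ltW yV)//.
    rewrite ge0_ler_powR ?nnegrE ?mulr_ge0 ?cmod_ge0 ?powR_ge0 ?(ltW yV)//.
    by rewrite (le_trans ler01 kernC_ge1).
  apply: (le_trans Kle); rewrite ler_wpM2l ?powR_ge0//.
  rewrite /y /g1 /g2; case: (leP x (2 * pi - x)) => h'.
    by rewrite mul1r lerDl powR_ge0.
  have -> : -1 * x + (2 * pi + m%:R^-1) = 2 * pi - x + m%:R^-1 by ring.
  by rewrite lerDr powR_ge0.
rewrite RintegralZl// RintegralD// E1 E2.
have q0 : 0 < p - 1 by rewrite subr_gt0.
have mE : (m%:R^-1 : R) `^ (1 - p) = m%:R `^ (p - 1).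
  by rewrite -powR_inv1 ?(ltW m0R)// -powRrM; congr powR; ring.
have -> : -1 * (2 * pi) + (2 * pi + m%:R^-1) = m%:R^-1 :> R by ring.
rewrite mE.
have a1 := powR_ge0 (1 * (2 * pi) + m%:R^-1 : R) (1 - p).
have a2 := powR_ge0 (2 * pi + m%:R^-1 : R) (1 - p).
set M := m%:R `^ (p - 1).
apply: (@le_trans _ _ (C * (M * (2 / (p - 1))))).
  rewrite ler_wpM2l ?powR_ge0//.
  rewrite [X in X <= _](_ : _ = (2 * M - (1 * (2 * pi) + m%:R^-1) `^ (1 - p)
    - (2 * pi + m%:R^-1) `^ (1 - p)) / (p - 1)); last first.
    by field; rewrite gt_eqF.
  by rewrite [M * _]mulrA ler_pM2r ?invr_gt0//; lra.
rewrite /C powRM ?powR_ge0 ?(le_trans ler01 kernC_ge1)//.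
rewrite /kern_const [leRHS]mulrDl mul1r.
rewrite [leLHS](_ : _ = kernC `^ p * (2 / (p - 1)) * ((m%:R `^ s) `^ p * M)).
  by rewrite lerDr mulr_ge0 ?powR_ge0.
ring.
Qed.

End kernel.

(** * Test functions on the torus and functions as distributions *)

Section test_functions_on_torus.
Context (R : realType) (d : nat).
Local Notation test := (test_function R d).
Local Notation torus := (torus R d).
Local Notation tp := (@torus_point R d).

Lemma measurable_floor_eq (c : R) (k : int) :
  measurable [set y : measurableTypeR R | Num.floor (c * y) = k].
Proof.
rewrite (_ : mkset _ = setT `&` (fun y => c * y) @^-1` `[k%:~R, (k + 1)%:~R[%classic).
  have : measurable_fun setT (fun y : measurableTypeR R => c * y).
    by apply: continuous_measurable_fun; exact: mulrl_continuous.
  by apply => //; exact: measurable_itv.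
rewrite setTI; apply/seteqP; split => y /=; rewrite in_itv/=.
  by move=> <-; exact: floor_itv.
by move=> /andP[ky yk]; apply/floor_def; rewrite ky yk.
Qed.

(** A continuous function is the pointwise limit of its samplings on the finer
    and finer grids, which are measurable for the product sigma-algebra because
    each of them takes countably many values on measurable boxes. *)
Lemma measurable_continuous_torus (u : 'rV[R]_d -> R) : continuous u ->
  measurable_fun [set: torus] (u \o tp).
Proof.
move=> cu.
pose grid (n : nat) (k : 'rV[int]_d) : 'rV[R]_d := \row_j ((k ord0 j)%:~R / n.+1%:R).
pose fl (n : nat) (x : torus) : 'rV[int]_d := \row_j Num.floor (n.+1%:R * tnth x j).
apply: (@measurable_fun_cvg _ _ _ setT (fun n x => u (grid n (fl n x)))).
  move=> n _ Y mY; rewrite setTI.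
  rewrite (_ : _ @^-1` Y = \bigcup_(k : 'rV[int]_d)
      if u (grid n k) \in Y then
        \bigcap_(j : 'I_d) [set x | Num.floor (n.+1%:R * tnth x j) = k ord0 j]
      else set0); last first.
    apply/seteqP; split => [x /= Yx|x [k _]].
      exists (fl n x) => //; rewrite mem_set// => j _ /=.
      by rewrite mxE.
    case: ifPn => // Yk /= H; suff -> : fl n x = k by exact: set_mem.
    by apply/rowP => j; rewrite mxE H.
  apply: countable_bigcupT_measurable; first exact: countableP.
  move=> k; case: ifPn => // _; apply: fin_bigcap_measurable => [|j _].
    exact: finite_finset.
  have := @measurable_tnth _ (measurableTypeR R) d j measurableT _
    (measurable_floor_eq n.+1%:R (k ord0 j)).
  by rewrite setTI.
move=> x _; apply: (continuous_cvg _ (cu _)).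
apply/cvg_ballP => e e0; near=> n.
have Ne : (n.+1%:R : R)^-1 < e by near: n; exact: (near_infty_natSinv_lt (PosNum e0)).
split => // i j.
rewrite !mxE /ball/=.
set X := tnth x j; set N : R := n.+1%:R.
have N0 : 0 < N by rewrite ltr0n.
rewrite -/N in Ne.
have /andP[h1 h2] := floor_itv (N * X).
rewrite intrD in h2.
set z := (Num.floor (N * X))%:~R in h1 h2 *.
have -> : X - z / N = (N * X - z) / N by field; rewrite gt_eqF.
rewrite ger0_norm ?divr_ge0 ?subr_ge0 ?(ltW N0)//.
apply: le_lt_trans Ne; rewrite ler_pdivrMr// mulVf ?gt_eqF//; lra.
Unshelve. all: by end_near. Qed.

Lemma periodic_int (h : 'rV[R]_d -> R) (T : 'rV[R]_d) (z : int) a :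
  periodic h T -> h (a + z%:~R *: T) = h a.
Proof.
move=> hT; have N n b : h (b + n%:R *: T) = h b by rewrite scaler_nat periodicn.
case: z => n; first exact: N.
by rewrite NegzE mulrNz scaleNr -(N n.+1) subrK.
Qed.

(** Reduction modulo the periods brings every point into the compact cube. *)
Lemma bounded_periodic (h : 'rV[R]_d -> R) : continuous h ->
  (forall j, periodic h ((2 * pi) *: unit_vec R j)) ->
  exists B : R, forall x, `|h x| <= B.
Proof.
move=> ch ph.
have T0 := twopi_gt0 R.
have cK : compact [set v : 'rV[R]_d | forall i, `[0, 2 * pi]%classic (v ord0 i)].
  by apply: (@rV_compact _ _ (fun=> `[0, 2 * pi]%classic)) => _; exact: segment_compact.
have chK := continuous_compact (continuous_subspaceT ch) cK.
have [B [_ hB]] := compact_bounded chK.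
exists (B + 1) => x.
pose z j := - Num.floor (x ord0 j / (2 * pi)).
have -> : h x = h (\row_j (x ord0 j + (z j)%:~R * (2 * pi))).
  have -> : \row_j (x ord0 j + (z j)%:~R * (2 * pi)) =
      x + \sum_j (z j)%:~R *: ((2 * pi) *: unit_vec R j).
    transitivity (x + \row_j ((z j)%:~R * (2 * pi))).
      by apply/rowP => j; rewrite !mxE.
    congr (_ + _); rewrite [LHS]row_sum_delta; apply: eq_bigr => j _.
    by rewrite mxE scalerA.
  elim: (index_enum _) => [|j s ih]; first by rewrite big_nil addr0.
  by rewrite big_cons addrCA addrC periodic_int.
apply: (hB (B + 1)); first by rewrite ltrDl.
exists (\row_j (x ord0 j + (z j)%:~R * (2 * pi))) => // j /=.
rewrite mxE in_itv/= /z mulrNz mulNr.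
have /andP[h1 h2] := floor_itv (x ord0 j / (2 * pi)).
move: h1 h2; set f := Num.floor _; rewrite ler_pdivlMr// ltr_pdivrMr// intrD mulrDl.
by move=> h1 h2; apply/andP; split; lra.
Qed.

Lemma cbmeas_test (phi : test) : cbmeas (fun x : torus => phi (tp x)).
Proof.
have /asboolP[sr si pp] := valP phi.
have [cr _] := sr [::]; have [ci _] := si [::].
split; split.
- exact: (measurable_continuous_torus cr).
- have [j x|B hB] := bounded_periodic cr; last by exists B => x; exact: hB.
  by congr complex.Re; exact: pp.
- exact: (measurable_continuous_torus ci).
- have [j x|B hB] := bounded_periodic ci; last by exists B => x; exact: hB.
  by congr complex.Im; exact: pp.
Qed.

End test_functions_on_torus.

Lemma uniform_cvg_near (U : choiceType) (R : realType) (F : nat -> U -> R) (f : U -> R) :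
  {uniform, F @ \oo --> f} ->
  forall e : R, 0 < e -> \forall n \near \oo, forall x, `|f x - F n x| < e.
Proof.
move=> Ff e e0; apply: (Ff [set h | forall y, `|f y - h y| < e]).
apply/uniform_nbhs; exists [set xy | ball xy.1 e xy.2]; split.
  exact: entourage_ball (PosNum e0).
by move=> h H y; exact: H.
Qed.

Section function_distributions.
Context (R : realType) (d : nat).
Local Notation test := (test_function R d).
Local Notation torus := (torus R d).
Local Notation tp := (@torus_point R d).
Local Notation mu := (torus_measure R d).

Lemma pairingD h (phi psi : test) : cbmeas h ->
  pairing h (phi + psi) = pairing h phi + pairing h psi.
Proof.
move=> bh; rewrite /pairing -[RHS](cintD mu); first last.
- by apply: cbmeasM => //; exact: cbmeas_test.
- by apply: cbmeasM => //; exact: cbmeas_test.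
by congr cintegral; apply/funext => x; rewrite -mulrDr.
Qed.

Lemma pairingZ h (c : R[i]) (phi : test) : cbmeas h ->
  pairing h (c *: phi) = c * pairing h phi.
Proof.
move=> bh; rewrite /pairing -[RHS](cintZ mu); last first.
  by apply: cbmeasM => //; exact: cbmeas_test.
by congr cintegral; apply/funext => x; rewrite mulrCA.
Qed.

Lemma pairing_suml (I : Type) (s : seq I) (a : I -> R[i]) (h : I -> torus -> R[i])
    (phi : test) : (forall i, cbmeas (h i)) ->
  \sum_(i <- s) a i * pairing (h i) phi =
  pairing (fun x => \sum_(i <- s) a i * h i x) phi.
Proof.
move=> bh; rewrite /pairing.
transitivity (\sum_(i <- s) cint mu (fun x => a i * (h i x * phi (tp x)))).
  apply: eq_bigr => i _; rewrite [RHS]cintZ//.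
  by apply: cbmeasM => //; exact: cbmeas_test.
rewrite -cint_sum; last first.
  move=> i; apply: cbmeasM; first exact: cbmeas_cst.
  by apply: cbmeasM => //; exact: cbmeas_test.
congr cint; apply/funext => x; rewrite mulr_suml; apply: eq_bigr => i _.
by rewrite mulrA.
Qed.

(** The boundedness proof is an argument, so that linearity can be attached to
    the functional as a canonical structure. *)
Definition pairing_fun h (bh : cbmeas h) (phi : test) : R[i]^o := pairing h phi.

Lemma pairing_linear h (bh : cbmeas h) : linear (pairing_fun bh).
Proof. by move=> c phi psi; rewrite /pairing_fun pairingD// pairingZ. Qed.

HB.instance Definition _ h (bh : cbmeas h) :=
  GRing.isLinear.Build R[i] test R[i]^o *:%R (pairing_fun bh) (pairing_linear bh).

Lemma cmod_cint_le (g : torus -> R[i]) (B : R) : cbmeas g ->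
  (forall x, cmod (g x) <= B) -> cmod (cint mu g) <= 2 * (B * fine (mu setT)).
Proof.
move=> [gr gi] gB.
have H (u : torus -> R) : bmeas u -> (forall x, `|u x| <= B) ->
    `|Rintegral mu setT u| <= B * fine (mu setT).
  move=> bu uB; have iu := bmeas_integrable mu bu.
  have [mu1 [C hC]] := bu.
  apply: le_trans (le_normr_Rintegral measurableT iu) _.
  rewrite -Rintegral_cst//; apply: le_Rintegral => //.
  - apply: bmeas_integrable; split; first exact: measurableT_comp.
    by exists C => x; rewrite normr_id.
  - exact: bmeas_integrable (bmeas_cst _).
rewrite (_ : cint mu g = (complex.Re (cint mu g))%:C%C +
   (0 +i* complex.Im (cint mu g))%C); last first.
  by case: (cint mu g) => a b; rewrite /GRing.add/= addr0 add0r.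
rewrite (le_trans (cmodD _ _))// mulr_natl mulr2n lerD//.
  rewrite cmod_real; apply: H => // x; apply: le_trans (gB x).
  by rewrite -lecR cmodE; exact: normc_ge_Re.
rewrite /cmod/= expr0n add0r sqrtr_sqr; apply: H => // x; apply: le_trans (gB x).
by rewrite /cmod; case: (g x) => a b /=; rewrite -sqrtr_sqr ler_wsqrtr// lerDr sqr_ge0.
Qed.

(** A bounded function defines a distribution of order 0: the pairing is controlled
    by the uniform distance of the test functions, without derivatives. *)
Lemma pairing_continuous h (bh : cbmeas h) (phi : nat -> test) (psi : test) :
  test_cvg phi psi ->
  (fun n => pairing_fun bh (phi n)) @ \oo --> pairing_fun bh psi.
Proof.
move=> /(_ [::])[/uniform_cvg_near cr /uniform_cvg_near ci].
have [_ [B hB]] := bmeas_cmod bh.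
pose V := fine (mu setT).
have V0 : 0 <= V by rewrite /V fine_ge0.
have B0 : 0 <= B.
  by apply: le_trans (hB [tuple 0 | i < d]); exact: normr_ge0.
apply/cvgrPdist_lt => e e0.
have eE : e = (complex.Re e)%:C%C by rewrite RRe_real// gtr0_real.
have e0' : 0 < complex.Re e by rewrite -ltcR -eE.
pose M := 4 * (B * V) + 1.
have M0 : 0 < M by rewrite ltr_wpDl// mulr_ge0// mulr_ge0.
pose dl := complex.Re e / M.
have dl0 : 0 < dl by exact: divr_gt0.
near=> n.
have h1 : forall x, `|complex.Re (psi x) - complex.Re (phi n x)| < dl.
  by near: n; exact: cr.
have h2 : forall x, `|complex.Im (psi x) - complex.Im (phi n x)| < dl.
  by near: n; exact: ci.
rewrite eE -linearB/= -cmodE ltcR.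
apply: (@le_lt_trans _ _ (2 * ((B * (2 * dl)) * V))).
  apply: cmod_cint_le.
    by apply: cbmeasM => //; exact: cbmeas_test.
  move=> x; rewrite cmodM ler_pM ?cmod_ge0//.
    by apply: le_trans (hB x); rewrite ler_norm.
  have -> : (psi - phi n) (tp x) =
     (complex.Re (psi (tp x)) - complex.Re (phi n (tp x)))%:C%C +
     (0 +i* (complex.Im (psi (tp x)) - complex.Im (phi n (tp x))))%C.
    rewrite [LHS](_ : _ = psi (tp x) - phi n (tp x))//.
    by case: (psi (tp x)) (phi n (tp x)) => [a b] [a' b'];
      rewrite /GRing.add/= /GRing.opp/= addr0 add0r.
  rewrite (le_trans (cmodD _ _))// mulr_natl mulr2n lerD//.
    by rewrite cmod_real ltW.
  by rewrite /cmod/= expr0n add0r sqrtr_sqr ltW.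
have -> : 2 * (B * (2 * dl) * V) = 4 * (B * V) * dl by ring.
rewrite /dl [X in X < _]mulrA ltr_pdivrMr// mulrC ltr_pM2l// /M; lra.
Unshelve. all: by end_near. Qed.

Definition fun_distribution h (bh : cbmeas h) : Defs.distribution R d :=
  Distribution (dist_fun := pairing_fun bh) (@pairing_continuous h bh).

Lemma represents_fun_distribution h (bh : cbmeas h) :
  represents h (fun_distribution bh).
Proof. by []. Qed.

End function_distributions.

(** * Tensor products of the kernels *)

Lemma powR_prod (R : realType) (I : finType) (F : I -> R) (p : R) :
  (forall i, 0 <= F i) -> (\prod_i F i) `^ p = \prod_i F i `^ p.
Proof.
move=> F0; have [] : 0 <= \prod_i F i /\ (\prod_i F i) `^ p = \prod_i F i `^ p.
  elim/big_ind2 : _ => [|x1 x2 y1 y2 [x0 <-] [y0 <-]|i _]; rewrite ?powR1//.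
  by split; [exact: mulr_ge0|rewrite powRM].
by [].
Qed.

Section tensor_kernel.
Context (R : realType) (d : nat).
Local Notation torus := (torus R d).
Local Notation tp := (@torus_point R d).
Local Notation mu := (torus_measure R d).
Local Notation circ := (circle_measure (R:=R)).

Definition tensor_kern (c : R) (m : 'I_d -> nat) (s : 'I_d -> R) (x : torus) : R[i] :=
  c%:C%C * \prod_(j < d) kern (m j) (s j) (tnth x j).

Lemma cbmeas_tensor c m s : cbmeas (tensor_kern c m s).
Proof.
apply: cbmeasM; first exact: cbmeas_cst.
apply: cbmeas_prod => j.
exact: (cbmeas_comp (cbmeas_kern _ _) (@measurable_tnth _ _ _ j)).
Qed.

Definition kern_coef (m : nat) (s : R) (k : int) : R[i] :=
  if 1 <= k <= m%:Z then ipow k s else 0.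

Lemma kern_coef0 m s : kern_coef m s 0 = 0.
Proof. by []. Qed.

Lemma harmonic_torus (k : freq d) (x : torus) :
  Defs.harmonic k (tp x) = \prod_(j < d) expi ((k ord0 j)%:~R * tnth x j).
Proof.
rewrite /Defs.harmonic /phase expi_sum; apply: eq_bigr => j _.
by rewrite /torus_point mxE.
Qed.

(** Orthogonality of the harmonics. *)
Lemma cint_kern_expi m s (k : int) :
  cint circ (fun x => kern m s x * expi ((- k)%:~R * x)) =
  (2 * pi)%:C%C * kern_coef m s k.
Proof.
have E : (fun x : measurableTypeR R => kern m s x * expi ((- k)%:~R * x)) =
  (fun x => \sum_(1 <= l < m.+1) ipow l%:Z s * expi ((l%:Z - k)%:~R * x)).
  apply/funext => x; rewrite /kern mulr_suml; apply: eq_bigr => l _.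
  by rewrite -mulrA -expiD -mulrDl -intrD.
rewrite E cint_sum; last first.
  by move=> l; apply: cbmeasM; [exact: cbmeas_cst|exact: cbmeas_expi].
under eq_bigr => l _.
  rewrite cintZ ?cint_circle_expi; last exact: cbmeas_expi.
  over.
rewrite /kern_coef; case: k {E} => n; last first.
  rewrite /= mulr0 big_nat big1// => l /andP[l1 _].
  by rewrite subr_eq0 mulr0.
under eq_bigr => l _ do rewrite subr_eq0 eqz_nat mulrC [_ * ipow _ _]mulrC.
rewrite (eq_bigr (fun l => if l == n then ipow l%:Z s * (2 * pi)%:C%C else 0)); last first.
  by move=> l _; case: eqP => _; rewrite ?mulr0// mulrC.
rewrite -big_mkcond big_nat1_eq ltnS !lez_nat; case: ifP => _; rewrite ?mulr0//.
by rewrite mulrC.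
Qed.

Lemma Fourier_coef_tensor c m s (k : freq d) :
  Fourier_coef (fun_distribution (cbmeas_tensor c m s)) k =
  c%:C%C * \prod_(j < d) kern_coef (m j) (s j) (k ord0 j).
Proof.
rewrite /Fourier_coef [X in _ * X](_ : _ = cint mu (fun x =>
    c%:C%C * \prod_(j < d) (kern (m j) (s j) (tnth x j) *
      expi ((- k ord0 j)%:~R * tnth x j)))); last first.
  congr cint; apply/funext => x; rewrite big_split/= mulrA; congr (_ * _).
  rewrite [LHS]harmonic_torus; apply: eq_bigr => j _; by rewrite mxE.
have bj j : cbmeas (fun x : measurableTypeR R =>
    kern (m j) (s j) x * expi ((- k ord0 j)%:~R * x)).
  by apply: cbmeasM; [exact: cbmeas_kern|exact: cbmeas_expi].
rewrite cintZ; last first.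
  by apply: cbmeas_prod => j; exact: (cbmeas_comp (bj j) (@measurable_tnth _ _ _ j)).
rewrite (cint_torus bj); under eq_bigr do rewrite cint_kern_expi.
rewrite big_split/= prodr_const card_ord mulrCA; congr (_ * _).
rewrite mulrA -rmorphXn/= -rmorphM/= mulVf ?mul1r//.
by rewrite expf_eq0 gt_eqF ?andbF// twopi_gt0.
Qed.

(** The partial sums are stationary once the cube contains the spectrum, so that
    the convergence of the Fourier series of a tensor kernel is a finite identity. *)
Lemma sum_box_kern m s (N : nat) (x : R) : (m <= N)%N ->
  \sum_(t < N.*2.+1) kern_coef m s ((t : nat)%:Z - N%:Z) *
    expi (((t : nat)%:Z - N%:Z)%:~R * x) = kern m s x.
Proof.
move=> mN; pose F (k : int) := kern_coef m s k * expi (k%:~R * x).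
rewrite -(big_mkord xpredT (fun t => F (t%:Z - N%:Z))).
(* The indices up to [N] are the frequencies [<= 0]. *)
rewrite (big_cat_nat (n := N.+1)) ?ltnS -?addnn ?leq_addr//=.
rewrite big_nat big1 ?add0r; last first.
  move=> t /andP[_ tN]; rewrite /F /kern_coef.
  have -> : 1 <= t%:Z - N%:Z = false by apply/negbTE; lia.
  by rewrite mul0r.
rewrite -[N.+1 in LHS]add1n -[(N + N).+1]addSn big_addn addnK.
rewrite (big_cat_nat (n := m.+1)) ?ltnS//=.
rewrite [X in _ + X]big_nat [X in _ + X]big1 ?addr0; last first.
  move=> t /andP[mt _]; rewrite /F /kern_coef PoszD addrK.
  have -> : t%:Z <= m%:Z = false by apply/negbTE; lia.
  by rewrite andbF mul0r.
rewrite /kern !big_nat; apply: eq_bigr => t /andP[t1 tm].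
rewrite /F /kern_coef PoszD addrK.
by have -> : 1 <= t%:Z <= m%:Z by lia.
Qed.

Lemma sum_box_tensor c m s (N : nat) (x : torus) : (forall j, (m j <= N)%N) ->
  \sum_(t : 'rV['I_N.*2.+1]_d)
    (c%:C%C * \prod_(j < d) kern_coef (m j) (s j) (box_freq t ord0 j)) *
    Defs.harmonic (box_freq t) (tp x) = tensor_kern c m s x.
Proof.
move=> mN.
under eq_bigr do rewrite harmonic_torus -mulrA -big_split/=.
rewrite -mulr_sumr /tensor_kern; congr (_ * _).
under [RHS]eq_bigr do rewrite -(sum_box_kern _ _ (mN _)).
rewrite bigA_distr_bigA/=.
rewrite (reindex (fun f : {ffun 'I_d -> 'I_N.*2.+1} => \row_j f j)); last first.
  exists (fun v : 'rV['I_N.*2.+1]_d => [ffun j => v ord0 j]) => v _.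
    by apply/ffunP => j; rewrite ffunE mxE.
  by apply/rowP => j; rewrite mxE ffunE.
by apply: eq_bigr => f _; apply: eq_bigr => j _; rewrite !mxE.
Qed.

Lemma tensor_Fourier_series c m s (a : freq d -> R[i]) :
  (forall k, a k = c%:C%C * \prod_(j < d) kern_coef (m j) (s j) (k ord0 j)) ->
  has_Fourier_series (fun_distribution (cbmeas_tensor c m s)) a.
Proof.
move=> aE phi; apply: cvg_near_cst.
exists (\max_j m j)%N => // N /= mN.
rewrite pairing_suml; last first.
  by move=> k; exact: cbmeas_test (harmonic_test_function R (box_freq k)).
congr cintegral; apply/funext => x; congr (_ * _).
under eq_bigr do rewrite aE.
apply: sum_box_tensor => j; apply: leq_trans mN.
exact: (leq_bigmax j).
Qed.

Lemma full_tensor c m s :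
  full_distribution (fun_distribution (cbmeas_tensor c m s)).
Proof.
move=> k; rewrite negb_forall => /existsP[j /negPn/eqP kj].
by rewrite Fourier_coef_tensor (bigD1 j)//= kj kern_coef0 mul0r mulr0.
Qed.

Lemma Weyl_tensor c m j r :
  is_Weyl_derivative j r (fun_distribution (cbmeas_tensor c m (fun=> 0)))
    (fun_distribution (cbmeas_tensor c m (fun i => if i == j then r else 0))).
Proof.
apply: tensor_Fourier_series => k; case: ifPn => [_|].
  rewrite Fourier_coef_tensor -mulrA; congr (_ * _).
  rewrite (bigD1 j)//= [in RHS](bigD1 j)//= eqxx mulrAC; congr (_ * _).
    rewrite /kern_coef; case: ifP => _; rewrite ?mul0r//.
    by rewrite ipow0r mul1r.
  by apply: eq_bigr => i /negbTE ->.
rewrite negb_forall => /existsP[i /negPn/eqP ki].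
by rewrite (bigD1 i)//= ki kern_coef0 mul0r mulr0.
Qed.

(** * L_p norms of the tensor kernels *)

(** For bounded functions the norm is computed by a real integral, to which
    [Rintegral_torus] applies. *)
Lemma cLnormE (h : torus -> R[i]) (p : R) : 0 < p -> cbmeas h ->
  cLnorm p h = ((Rintegral mu setT (fun x => cmod (h x) `^ p)) `^ p^-1)%:E.
Proof.
move=> p0 bh; rewrite /cLnorm unlock -poweR_EFin; congr (_ `^ _)%E.
rewrite /Rintegral fineK; last first.
  apply: integrable_fin_num => //.
  apply: (@bmeas_integrable _ _ _ mu (fun x => cmod (h x) `^ p)).
  by apply: bmeas_powR; [exact: ltW|exact: bmeas_cmod|move=> x; exact: cmod_ge0].
apply: eq_integral => x _; rewrite /= ger0_norm//; exact: cmod_ge0.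
Qed.

Lemma Rintegral_tensor (c : R) m s p : 0 <= c -> 0 < p ->
  Rintegral mu setT (fun x => cmod (tensor_kern c m s x) `^ p) =
  c `^ p * \prod_(j < d) Rintegral circ setT (fun x => cmod (kern (m j) (s j) x) `^ p).
Proof.
move=> c0 p0.
have bj j : bmeas (fun x : measurableTypeR R => cmod (kern (m j) (s j) x) `^ p).
  apply: bmeas_powR; first exact: ltW.
    exact: bmeas_cmod (cbmeas_kern _ _).
  by move=> x; exact: cmod_ge0.
have bp : bmeas (fun x : torus => \prod_(j < d) cmod (kern (m j) (s j) (tnth x j)) `^ p).
  by apply: bmeas_prod => j; exact: (bmeas_comp (bj j) (@measurable_tnth _ _ _ j)).
rewrite -(Rintegral_torus bj) -RintegralZl//; last exact: bmeas_integrable.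
apply: eq_Rintegral => x _.
rewrite /tensor_kern cmodM cmod_real ger0_norm// cmod_prod.
rewrite powRM ?powR_prod//; first by move=> j; exact: cmod_ge0.
by apply: prodr_ge0 => j _; exact: cmod_ge0.
Qed.

End tensor_kernel.

(** * The extremal functions *)

Lemma powRD_gt0 (R : realType) (T x y : R) : 0 < T ->
  T `^ (x + y) = T `^ x * T `^ y.
Proof. by move=> T0; rewrite powRD// (gt_eqF T0) implybT. Qed.

Lemma prod_powR (R : realType) (I : finType) (a : I -> R) (T : R) : 0 < T ->
  \prod_i T `^ a i = T `^ (\sum_i a i).
Proof.
move=> T0; elim/big_rec2 : _ => [|i x y _ ->]; first by rewrite powRr0.
by rewrite powRD_gt0.
Qed.

(** A cluster point of the sequence would have two of its terms within distance
    [e / 2]. *)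
Lemma not_precompact_separated (R : realType) (M : pseudoMetricType R)
    (A : set M) (u : nat -> M) (e : R) : 0 < e ->
  (forall n, A (u n)) -> (forall n k, (n < k)%N -> ~ ball (u k) e (u n)) ->
  ~ precompact A.
Proof.
move=> e0 Au sep; rewrite precompactE => cA.
have uA : (u @ \oo) (closure A).
  by exists 0%N => // n _ /=; apply: subset_closure.
have [x [_ xu]] := cA (u @ \oo) _ uA.
have e20 : 0 < e / 2 by rewrite divr_gt0.
have F (N : nat) : exists2 n, (N <= n)%N & ball x (e / 2) (u n).
  have [|_ [[n Nn <-] xn]] := xu (u @` [set n | (N <= n)%N]) _ _ (nbhsx_ballx x _ e20).
    by exists N => // n Nn /=; exists n.
  by exists n.
have [n _ xn] := F 0%N; have [k nk xk] := F n.+1.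
apply: (sep n k nk); rewrite (splitr e).
by apply: ball_triangle xn; exact: ball_sym.
Qed.

Section extremal.
Context (R : realType) (d : nat) (p r a : 'I_d -> R) (q : R).
Hypotheses (q1 : 1 < q) (p1 : forall i, 1 < p i) (r0 : forall i, 0 < r i).
Hypotheses (a0 : forall i, 0 <= a i) (a1 : \sum_i a i = 1).
Hypothesis ar : forall i, a i * r i <= (p i)^-1 - q^-1.
Local Notation mu := (torus_measure R d).
Local Notation circ := (circle_measure (R:=R)).

Definition degree (T : R) (j : 'I_d) : nat := Num.truncn (T `^ a j).

(** Dominates [kern_const (p i) ^+ d] for all [i] at once and is at least 1, so
    that its inverse only decreases when raised to the power [p i]. *)
Definition norm_const : R := 1 + \sum_i kern_const (p i) ^+ d.

(** [T^(1/q - 1)] makes the L_q norm of the product of the kernels, of order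
    [T^(1 - 1/q)], comparable to 1. *)
Definition amplitude (T : R) : R := norm_const^-1 * T `^ (q^-1 - 1).

Lemma norm_const_ge i : kern_const (p i) ^+ d <= norm_const.
Proof.
rewrite /norm_const (bigD1 i)//= addrCA lerDl addr_ge0// sumr_ge0// => j _.
by rewrite exprn_ge0// (le_trans ler01)// kern_const_ge1.
Qed.

Lemma norm_const_ge1 : 1 <= norm_const.
Proof.
rewrite lerDl sumr_ge0// => j _.
by rewrite exprn_ge0// (le_trans ler01)// kern_const_ge1.
Qed.

Lemma norm_const_gt0 : 0 < norm_const.
Proof. exact: lt_le_trans norm_const_ge1. Qed.

Lemma amplitude_ge0 T : 0 <= amplitude T.
Proof. by rewrite mulr_ge0 ?powR_ge0// invr_ge0 ltW// norm_const_gt0. Qed.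

Lemma degree_gt0 T j : 1 <= T -> (0 < degree T j)%N.
Proof. by move=> T1; rewrite truncn_gt0 -[leLHS](powRr0 T) ler_powR. Qed.

Lemma degree_le T j : (degree T j)%:R <= T `^ a j.
Proof. by rewrite truncn_le powR_ge0. Qed.

Lemma degree_ge T j : 1 <= T -> T `^ a j <= 2 * (degree T j)%:R.
Proof.
move=> T1; have m1 := degree_gt0 j T1.
apply: le_trans (ltW (truncnS_gt _)) _; rewrite -/(degree T j).
by rewrite -natrM ler_nat mul2n -addnn -addn1 leq_add2l.
Qed.

Lemma prod_powR_exponents T : 0 < T -> T = \prod_j T `^ a j.
Proof. by move=> T0; rewrite prod_powR// a1 powRr1// ltW. Qed.

(** The exponents of [T] add up to
    [(1/q - 1) p_i + a_i r_i p_i + (p_i - 1)], which is at most 0 exactly because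
    [a_i r_i <= 1/p_i - 1/q]. *)
Lemma Lp_extremal T i : 1 <= T ->
  (cLnorm (p i) (tensor_kern (amplitude T) (degree T)
     (fun k => if k == i then r i else 0%R)) <= 1)%E.
Proof.
move=> T1; have T0 : 0 < T by exact: lt_le_trans T1.
set P := p i; have P1 : 1 < P := p1 i.
have P0 : 0 < P by exact: lt_trans P1.
set m := degree T; set s := fun k => _.
have s0 k : 0 <= s k by rewrite /s; case: eqP => // _; exact: ltW.
rewrite cLnormE//; last exact: cbmeas_tensor.
rewrite lee_fin (_ : 1 = 1 `^ P^-1); last by rewrite powR1.
rewrite ge0_ler_powR ?nnegrE ?invr_ge0 ?(ltW P0)//.
  by rewrite Rintegral_ge0// => x _; exact: powR_ge0.
rewrite Rintegral_tensor ?amplitude_ge0//.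
set A := kern_const P; have A1 : 1 <= A by exact: kern_const_ge1.
have C0 := norm_const_gt0.
have powT_ge0 x : 0 <= T `^ x := powR_ge0 T x.
have Pk : \prod_(k < d) Rintegral circ setT (fun x => cmod (kern (m k) (s k) x) `^ P)
    <= A ^+ d * (T `^ (a i * r i * P) * T `^ (P - 1)).
  apply: (@le_trans _ _ (\prod_(k < d) (A * (T `^ (a k * s k * P) * T `^ (a k * (P - 1)))))).
    apply: ler_prod => k _; apply/andP; split.
      by rewrite Rintegral_ge0// => x _; exact: powR_ge0.
    have mk0 : (0 : R) < (m k)%:R by rewrite ltr0n degree_gt0.
    apply: le_trans (kern_Lp_bound (degree_gt0 k T1) (s0 k) P1) _.
    rewrite ler_wpM2l ?(le_trans ler01 A1)//.
    rewrite ler_pM ?powR_ge0// ?powRrM.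
      rewrite ge0_ler_powR ?nnegrE ?powR_ge0 ?(ltW P0)//.
      by rewrite ge0_ler_powR ?nnegrE ?powR_ge0 ?degree_le.
    by rewrite ge0_ler_powR ?nnegrE ?powR_ge0 ?degree_le ?subr_ge0 ?(ltW P1).
  rewrite big_split/= prodr_const card_ord ler_wpM2l ?exprn_ge0 ?(le_trans ler01 A1)//.
  rewrite big_split/= !prod_powR// -!mulr_suml a1 mul1r.
  rewrite (bigD1 i)//= big1 ?addr0; last by move=> k /negbTE ki; rewrite /s ki mulr0.
  by rewrite /s eqxx.
apply: le_trans (ler_wpM2l (powR_ge0 _ _) Pk) _.
rewrite /amplitude powRM ?invr_ge0 ?(ltW C0)// -powRrM.
rewrite [leLHS](_ : _ = (norm_const^-1 `^ P * A ^+ d) *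
   (T `^ ((q^-1 - 1) * P) * (T `^ (a i * r i * P) * T `^ (P - 1)))); last by ring.
rewrite -!powRD_gt0//.
rewrite mulr_ile1 ?mulr_ge0 ?powR_ge0 ?exprn_ge0 ?(le_trans ler01 A1)//.
  apply: (@le_trans _ _ (norm_const^-1 * norm_const)); last by rewrite mulVf// gt_eqF.
  rewrite ler_pM ?powR_ge0 ?exprn_ge0 ?(le_trans ler01 A1) ?norm_const_ge//.
  apply: ge1r_powR; last exact: ltW.
  by rewrite invr_gt0 C0 invf_le1// norm_const_ge1.
rewrite -[leRHS](powRr0 T) ler_powR//.
have : a i * r i * P <= (P^-1 - q^-1) * P by rewrite ler_pM2r// ar.
rewrite mulrBl mulVf ?gt_eqF// => h; lra.
Qed.

(** How far the extremal function may fall, on its box, below the upper bound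
    [norm_const^-1 * S] for its modulus: each variable contributes [cos 1] from
    the kernel and [1 / 2] from rounding the degree. *)
Definition box_ratio : R := (cos 1 / 2) ^+ d.

Lemma box_ratio_gt0 : 0 < box_ratio.
Proof. by rewrite exprn_gt0// divr_gt0// cos1_gt0. Qed.

Lemma box_ratio_le1 : box_ratio <= 1.
Proof.
have c0 := cos1_gt0 R.
rewrite exprn_ile1 ?divr_ge0 ?(ltW c0)// ler_pdivrMr// mul1r.
by rewrite (le_trans (cos_le1 _))// ler1n.
Qed.

Definition separation : R := norm_const^-1 * box_ratio / 2.

Lemma separation_gt0 : 0 < separation.
Proof.
by rewrite divr_gt0// mulr_gt0 ?invr_gt0 ?norm_const_gt0 ?box_ratio_gt0.
Qed.

Lemma amplitude_powR (S : R) : 0 < S -> amplitude (S `^ q) * S `^ q = norm_const^-1 * S.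
Proof.
move=> S0; have q0 : 0 < q by exact: lt_trans q1.
rewrite /amplitude -mulrA; congr (_ * _).
rewrite -powRrM -powRD_gt0//.
have -> : q * (q^-1 - 1) + q = 1 by field; rewrite gt_eqF.
by rewrite powRr1// ltW.
Qed.

(** The parameter is [S = T^(1/q)], the order of magnitude of the maximum of the
    function. *)
Definition extremal (S : R) : torus R d -> R[i] :=
  tensor_kern (amplitude (S `^ q)) (degree (S `^ q)) (fun=> 0).

Lemma extremal_le S x : 1 <= S -> cmod (extremal S x) <= norm_const^-1 * S.
Proof.
move=> S1; have S0 : 0 < S by exact: lt_le_trans S1.
rewrite -amplitude_powR// /extremal /tensor_kern cmodM cmod_real.
rewrite ger0_norm ?amplitude_ge0// ler_wpM2l ?amplitude_ge0//.
rewrite cmod_prod [leRHS]prod_powR_exponents ?powR_gt0//.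
apply: ler_prod => j _; rewrite cmod_ge0/=.
apply: le_trans (cmod_kern_le _ _ (lexx 0)) _.
by rewrite powRr0 mulr1 degree_le.
Qed.

Lemma extremal_ge S (x : torus R d) : 1 <= S ->
  (forall j, 0 <= tnth x j <= (degree (S `^ q) j)%:R^-1) ->
  norm_const^-1 * S * box_ratio <= cmod (extremal S x).
Proof.
move=> S1 xj; have S0 : 0 < S by exact: lt_le_trans S1.
have q0 : 0 < q by exact: lt_trans q1.
have T1 : 1 <= S `^ q by rewrite -(powRr0 S) ler_powR// ltW.
rewrite -amplitude_powR// /extremal /tensor_kern cmodM cmod_real.
rewrite ger0_norm ?amplitude_ge0// -mulrA ler_wpM2l ?amplitude_ge0//.
rewrite cmod_prod [X in X * _ <= _]prod_powR_exponents ?powR_gt0//.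
rewrite /box_ratio -[X in _ ^+ X]card_ord -prodr_const -big_split/=.
have c0 := cos1_gt0 R.
apply: ler_prod => j _; rewrite mulr_ge0 ?powR_ge0 ?divr_ge0 ?(ltW c0)//=.
have /andP[x0 x1] := xj j.
have mj : (0 : R) < (degree (S `^ q) j)%:R by rewrite ltr0n degree_gt0.
apply: le_trans (cmod_kern0_ge x0 _); last first.
  by rewrite mulrC -ler_pdivlMr// div1r.
rewrite (_ : _%:R * cos 1 = 2 * (degree (S `^ q) j)%:R * (cos 1 / 2)); last by field.
by rewrite ler_wpM2r ?divr_ge0 ?(ltW c0)// degree_ge.
Qed.

(** On the box where [extremal S'] is large, [extremal S] is at most half of the
    lower bound for [extremal S'], and the measure of the box compensates the
    power [q] of this bound. *)
Lemma extremal_separated S S' : 1 <= S -> S * (2 / box_ratio) <= S' ->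
  (separation%:E <= cLnorm q (extremal S' \- extremal S)%R)%E.
Proof.
move=> S1 SS'; have dl0 := box_ratio_gt0; have dl1 := box_ratio_le1.
have S'1 : 1 <= S'.
  apply: (le_trans S1); apply: le_trans SS'.
  apply: ler_peMr; first exact: le_trans ler01 S1.
  by rewrite ler_pdivlMr// mul1r (le_trans dl1)// ler1n.
have S'0 : 0 < S' by exact: lt_le_trans S'1.
have q0 : 0 < q by exact: lt_trans q1.
have C0 := norm_const_gt0.
have T1 : 1 <= S' `^ q by rewrite -(powRr0 S') ler_powR// ltW.
have be Y : cbmeas (extremal Y) by exact: cbmeas_tensor.
have bd : cbmeas (extremal S' \- extremal S)%R.
  have := cbmeasD (be S') (cbmeasM (cbmeas_cst (-1)) (be S)).
  by congr cbmeas; apply/funext => x /=; rewrite mulN1r.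
rewrite cLnormE// lee_fin.
pose I j : R -> R := \1_`[0, (degree (S' `^ q) j)%:R^-1].
have mD j : (0 : R) < (degree (S' `^ q) j)%:R by rewrite ltr0n degree_gt0.
have bI j : bmeas (I j : measurableTypeR R -> R).
  split; first by apply: measurable_indic; exact: measurable_itv.
  by exists 1 => x; rewrite /I indicE; case: (_ \in _); rewrite ?normr1 ?normr0.
have bP : bmeas (fun x : torus R d => \prod_j I j (tnth x j)).
  by apply: bmeas_prod => j; exact: (bmeas_comp (bI j) (@measurable_tnth _ _ _ j)).
have bq : bmeas (fun x => cmod ((extremal S' \- extremal S)%R x) `^ q).
  apply: bmeas_powR; [exact: ltW|exact: bmeas_cmod|move=> x; exact: cmod_ge0].
have sep0 := separation_gt0.
rewrite -[separation]powRr1 ?(ltW sep0)// -(@mulfV _ q) ?gt_eqF// powRrM.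
rewrite ge0_ler_powR ?nnegrE ?invr_ge0 ?powR_ge0 ?(ltW q0)//.
  by rewrite Rintegral_ge0// => x _; exact: powR_ge0.
pose L := separation * S'.
have L0 : 0 < L by exact: mulr_gt0.
apply: (@le_trans _ _ (Rintegral mu setT (fun x => L `^ q * \prod_j I j (tnth x j)))).
  rewrite RintegralZl//; last exact: bmeas_integrable.
  rewrite (Rintegral_torus bI) /L powRM ?(ltW S'0) ?(ltW sep0)//.
  rewrite -mulrA; apply: ler_peMr; first exact: powR_ge0.
  have pi1 := pi_ge2 R.
  under eq_bigr => j _.
    rewrite /I Rintegral_circle_indic; last first.
      rewrite invr_ge0 ltW//= (@le_trans _ _ 1)//; last lra.
      by rewrite invf_le1// ler1n degree_gt0.
    over.
  rewrite [X in _ <= X * _]prod_powR_exponents ?powR_gt0//.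
  rewrite -big_split/=.
  apply: (@le_trans _ _ (\prod_(j < d) 1)); first by rewrite big1.
  apply: ler_prod => j _; rewrite ler01/= ler_pdivlMr// mul1r.
  exact: degree_le.
apply: le_Rintegral => //.
- apply: bmeas_integrable; apply: bmeasM => //; exact: bmeas_cst.
- exact: bmeas_integrable.
move=> x _; have [xI|] := boolP [forall j, tnth x j \in `[0, (degree (S' `^ q) j)%:R^-1]]; last first.
  rewrite negb_forall => /existsP[j xj].
  rewrite (bigD1 j)//= /I indicE [_ \in _](_ : _ = false) ?mul0r ?mulr0 ?powR_ge0//.
  by apply/negbTE; apply: contra xj => /set_mem.
have {}xI j : 0 <= tnth x j <= (degree (S' `^ q) j)%:R^-1.
  by have := forallP xI j; rewrite in_itv.
rewrite big1 ?mulr1; last first.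
  by move=> j _; rewrite /I indicE mem_set//=; rewrite in_itv; exact: xI.
rewrite ge0_ler_powR ?nnegrE ?cmod_ge0 ?(ltW q0) ?(ltW L0)//.
apply: le_trans (cmodB _ _).
have h1 := extremal_ge S'1 xI; have h2 := extremal_le x S1.
apply: le_trans (lerB h1 h2).
rewrite /L /separation.
have h3 : S * 2 <= S' * box_ratio by move: SS'; rewrite mulrA ler_pdivrMr.
have h4 : norm_const^-1 * (S * 2) <= norm_const^-1 * (S' * box_ratio).
  by rewrite ler_wpM2l// invr_ge0 ltW.
rewrite (_ : _ * S' = norm_const^-1 * (S' * box_ratio) / 2); last by field; rewrite gt_eqF.
rewrite mulrA in h4; rewrite -[_ * S' * box_ratio]mulrA.
move: (norm_const^-1 * S) (norm_const^-1 * (S' * box_ratio)) h4 => v w vw.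
by rewrite lerBrDr [leRHS]splitr lerD2l ler_pdivlMr.
Qed.

Lemma cLnorm_bounded_lty (h : torus R d -> R[i]) : cbmeas h -> (cLnorm q h < +oo)%E.
Proof. by move=> bh; rewrite cLnormE ?ltry// (lt_trans ltr01). Qed.

Lemma extremal_W_class S : 1 <= S ->
  W_class r p (fun_distribution (cbmeas_tensor (amplitude (S `^ q))
    (degree (S `^ q)) (fun=> 0))).
Proof.
move=> S1; split; first exact: full_tensor.
move=> j; eexists; first exact: Weyl_tensor.
eexists; first exact: represents_fun_distribution.
have bt := cbmeas_tensor (amplitude (S `^ q)) (degree (S `^ q))
   (fun i => if i == j then r j else 0).
split; first by split; [exact: bt.1.1|exact: bt.2.1].
apply: Lp_extremal; rewrite -(powRr0 S) ler_powR// ltW//.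
exact: lt_trans q1.
Qed.

Lemma not_compactly_embedded_of_exponents :
  ~ compactly_embedded (ltW q1) (W_class r p).
Proof.
move=> [_]; have dl0 := box_ratio_gt0; have dl1 := box_ratio_le1.
pose S n := (2 / box_ratio) ^+ n.
have k1 : 1 <= 2 / box_ratio by rewrite ler_pdivlMr// mul1r (le_trans dl1)// ler1n.
have S1 n : 1 <= S n by exact: exprn_ege1.
have bt n : cbmeas (extremal (S n)) by exact: cbmeas_tensor.
have mt n : cmeasurable (extremal (S n)).
  by split; [exact: (bt n).1.1|exact: (bt n).2.1].
pose u n : Defs.Lspace d (ltW q1) :=
  @Defs.LspaceFun _ _ _ (ltW q1) _ (mt n) (cLnorm_bounded_lty (bt n)).
apply: (@not_precompact_separated _ _ _ u separation separation_gt0).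
  move=> n; eexists; first exact: (extremal_W_class (S1 n)).
  exact: represents_fun_distribution.
move=> n k nk; rewrite /ball/= /Lball/= ltNge => /negP; apply.
apply: extremal_separated => //.
rewrite /S -exprSr; exact: ler_weXn2l.
Qed.

End extremal.

Theorem theorem3 (R : realType) (d : nat) (r p : 'I_d -> R) (q : R)
    (hd : (2 <= d)%N)
    (hr : forall k : 'I_d, 0 < r k)
    (hq : 1 < q)
    (hp : forall k : 'I_d, 1 < p k /\ p k <= q)
    (hj : exists j : 'I_d,
      1 <= \sum_(i < d) (r i)^-1 * ((p i)^-1 - (p j)^-1)) :
  ~ compactly_embedded (ltW hq) (W_class r p).
Proof.
have q0 : 0 < q by exact: lt_trans hq.
have p0 k : 0 < p k by apply: lt_trans (hp k).1.
pose b i := (r i)^-1 * ((p i)^-1 - q^-1).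
have b0 i : 0 <= b i.
  by rewrite mulr_ge0 ?invr_ge0 ?(ltW (hr i))// subr_ge0 lef_pV2 ?posrE// (hp i).2.
have b1 : 1 <= \sum_i b i.
  have [j] := hj; move/le_trans; apply; apply: ler_sum => i _.
  rewrite ler_wpM2l ?invr_ge0 ?(ltW (hr i))// lerB// lef_pV2 ?posrE//.
  exact: (hp j).2.
have B0 : 0 < \sum_i b i by exact: lt_le_trans b1.
apply: (@not_compactly_embedded_of_exponents _ _ p r (fun i => b i / \sum_i b i)) => //.
- by move=> i; exact: (hp i).1.
- by move=> i; rewrite divr_ge0// ltW.
- by rewrite -mulr_suml divff// gt_eqF.
- move=> i; rewrite mulrAC.
  have -> : b i * r i = (p i)^-1 - q^-1 by rewrite /b mulrAC mulVf ?mul1r// gt_eqF.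
  rewrite ler_pdivrMr// ler_peMr// subr_ge0 lef_pV2 ?posrE//; exact: (hp i).2.
Qed.
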